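(* In the setting given in the context, assume that $\mathcal S_H$ is invertible on $X$. Then, for all sufficiently large $n$, the extended operator $\overline{\mathcal S}_{H,n}=\mathcal I-P_n\mathcal K_HP_n$ on $X$ and the projected operator $\mathcal S_{H,n}=\mathcal I_{X_n}-P_n\mathcal K_H|_{X_n}$ on $X_n$ are invertible. Moreover (for such $n$), $$\|\overline{\mathcal S}_{H,n}^{-1}\|\le\frac{\|\mathcal S_H^{-1}\|}{1-\|\mathcal S_H^{-1}\|\,\|\overline{\mathcal S}_{H,n}-\mathcal S_H\|}$$ and $$\|\mathcal S_{H,n}^{-1}\|\le\|\overline{\mathcal S}_{H,n}^{-1}\|.$$ In particular, both families of inverse norms are uniformly bounded for sufficiently large $n$.
   Context: Let $\Omega$ be a domain in $\mathbb R^2$ or $\mathbb R^3$ with boundary $\Gamma$, and let $\mathcal A$ be a scalar second-order elliptic partial differential operator with real, possibly variable, coefficients. The global boundary value problem is $\mathcal A u=f$ in $\Omega$, $u=g$ on $\Gamma$. Slab decomposition. $\Omega$ is tessellated into $N_{\rm ds}+1$ consecutive equispaced thin slabs of fixed width $H>0$, separated by internal interfaces $\Gamma_1,\dots,\Gamma_{N_{\rm ds}}$ (in order); distinct interfaces are separated by a positive distance. For $j=1,\dots,N_{\rm ds}$, the double slab $\Psi_j$ is the union of the two neighbouring single slabs that share $\Gamma_j$ (together with $\Gamma_j$). Thus $\Psi_j$ is enclosed between $\Gamma_{j-1}$ and $\Gamma_{j+1}$, its central interface is $\Gamma_j$, and the rest of $\partial\Psi_j$ lies on $\Gamma$. For $j=1$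 (resp. $j=N_{\rm ds}$) the interface $\Gamma_{j-1}$ (resp. $\Gamma_{j+1}$) is replaced by a part of $\Gamma$, and there is no corresponding unknown or operator. Solution-transfer operators. Let $G^{(j)}(x,y)$ ($x\in\Psi_j$, $y\in\partial\Psi_j$) be the Poisson kernel of $\mathcal A$ in $\Psi_j$, i.e. the solution of $\mathcal A v=0$ in $\Psi_j$, $v=\varphi$ on $\partial\Psi_j$ is $v(x)=\int_{\partial\Psi_j}G^{(j)}(x,y)\varphi(y)\,dy$. Define, for each existing internal interface $\Gamma_{j\pm1}$, $\mathcal S_{j,j\pm1}:L^2(\Gamma_{j\pm1})\to L^2(\Gamma_j)$ by $[\mathcal S_{j,j\pm1}\varphi](x)=\int_{\Gamma_{j\pm1}}G^{(j)}(x,y)\varphi(y)\,dy$, $x\in\Gamma_j$. Equilibrium operator. On $X=\bigoplus_{j=1}^{N_{\rm ds}}L^2(\Gamma_j)$, let $(\mathcal K_H u)_j=\mathcal S_{j,j-1}u_{j-1}+\mathcal S_{j,j+1}u_{j+1}$ (terms with index $0$ or $N_{\rm ds}+1$ omitted), and let $\mathcal S_H=\mathcal I-\mathcal K_H$. Standing assumptions. $H>0$ is fixed; the global boundary value problem and the local Dirichlet problems on all single slabs and all double slabs are uniquely solvable; the local Dirichlet solution kernels $G^{(j)}(x,y)$ are sufficiently smooth away from the diagonal $x=y$ (in particular they are smooth on the compact products $\Gamma_j\times\Gamma_{j\pm1}$). Approximation. $X_1\subset X_2\subset\cdots\subset X$ is a nested sequence of finite-dimensional subspaces of $X$ whose union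 is dense in $X$, and $P_n$ is the orthogonal projection of $X$ onto $X_n$. The projected trace operator is $\mathcal S_{H,n}=\mathcal I_{X_n}-P_n\mathcal K_H|_{X_n}:X_n\to X_n$, and its extension to $X$ is $\overline{\mathcal S}_{H,n}=\mathcal I-P_n\mathcal K_HP_n:X\to X$. All norms are the Hilbert-space operator norms on $X$ and $X_n$. *)

(* Defs.v *)
From HB Require Import structures.
From mathcomp Require Import all_boot all_order all_algebra.
From mathcomp Require Import ring_quotient sesquilinear ring.
From mathcomp Require Import all_classical all_reals all_analysis.

Set Implicit Arguments.
Unset Strict Implicit.
Unset Printing Implicit Defensive.
Import Order.TTheory GRing.Theory Num.Def Num.Theory.
Import numFieldNormedType.Exports.

Local Open Scope classical_set_scope.
Local Open Scope ring_scope.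

Definition edot (R : realType) (d : nat) (x y : 'rV[R]_d) : R :=
  \sum_i x 0 i * y 0 i.

Definition enorm (R : realType) (d : nat) (x : 'rV[R]_d) : R :=
  Num.sqrt (edot x x).

(* Volume of the s-dimensional ball of diameter 1 *)
Fixpoint half_ball_volume (R : realType) (s : nat) : R :=
  if s is s'.+2 then pi / (2 * s'.+2%:R) * half_ball_volume R s' else 1.

Section Hausdorff.
Context {R : realType} {d : nat}.
Notation V := 'rV[R]_d.
Local Open Scope ereal_scope.

Definition ediam (A : set V) : \bar R :=
  ereal_sup (0 |` [set (enorm (x - y))%:E | x in A & y in A]).

Definition hausdorff_gauge (s : nat) (A : set V) : \bar R :=
  if A == set0 then 0 else (half_ball_volume R s)%:E * ediam A ^+ s.

Definition hausdorff_pre (s : nat) (e : R) (A : set V) : \bar R :=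
  ereal_inf [set \sum_(k <oo) hausdorff_gauge s (C k) |
             C in [set C : (set V)^nat | (forall k, ediam (C k) <= e%:E) /\
                                         A `<=` \bigcup_k C k]].

Definition hausdorff (s : nat) (A : set V) : \bar R :=
  ereal_sup [set hausdorff_pre s e A | e in [set e : R | (0 < e)%R]].

(* The (d-1)-dimensional Hausdorff measure restricted to A; the factor
   half_ball_volume makes it agree with Lebesgue measure on flat pieces. *)
Definition surface (A : set V) : set V -> \bar R :=
  fun B => hausdorff d.-1 (B `&` A).

Lemma half_ball_volume_ge0 s : (0 <= half_ball_volume R s)%R.
Proof.
have [n] := ubnP s; elim: n s => // n IH [|[|s]] //= sn.
by rewrite mulr_ge0 ?divr_ge0 ?mulr_ge0 ?pi_ge0// IH// ltnW.
Qed.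

Lemma ediam_ge0 A : 0 <= ediam A.
Proof. by apply: ereal_sup_ubound; left. Qed.

Lemma hausdorff_gauge_ge0 s A : 0 <= hausdorff_gauge s A.
Proof.
rewrite /hausdorff_gauge; case: ifP => // _.
by rewrite mule_ge0 ?lee_fin ?half_ball_volume_ge0 ?expe_ge0 ?ediam_ge0.
Qed.

Lemma hausdorff_pre_ge0 s e A : 0 <= hausdorff_pre s e A.
Proof.
apply: le_ereal_inf_tmp => _ [C _ <-].
by apply: nneseries_ge0 => k _ _; exact: hausdorff_gauge_ge0.
Qed.

Lemma hausdorff_pre_sub s e (A : set V) (F : (set V)^nat) :
  A `<=` \bigcup_n F n ->
  hausdorff_pre s e A <= \sum_(n <oo) hausdorff_pre s e (F n).
Proof.
move=> AF; have [[i ioo]|] := pselect (exists i, hausdorff_pre s e (F i) = +oo).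
  rewrite (eseries_pinfty _ _ ioo) ?leey// => n _.
  by rewrite -ltNye (lt_le_trans _ (hausdorff_pre_ge0 _ _ _)).
rewrite -forallNE => Foo.
apply/lee_addgt0Pr => r r0.
apply: le_trans (epsilon_trick predT _ (ltW r0)); last first.
  by move=> n; exact: hausdorff_pre_ge0.
pose P n (B : (set V)^nat) := [/\ (forall k, ediam (B k) <= e%:E),
  F n `<=` \bigcup_k B k & \sum_(k <oo) hausdorff_gauge s (B k) <=
    hausdorff_pre s e (F n) + (r / (2 ^ n.+1)%:R)%:E].
have [G PG] : {G : ((set V)^nat)^nat & forall n, P n (G n)}.
  apply: (@choice _ _ P) => n.
  have en1 : (0 < r / (2 ^ n.+1)%:R)%R by rewrite divr_gt0// ltr0n expn_gt0.
  have fin : hausdorff_pre s e (F n) \is a fin_num.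
    by rewrite ge0_fin_numE ?hausdorff_pre_ge0// ltey; apply/eqP/Foo.
  have [_ [B [mB FB] <-] xS] := lb_ereal_inf_adherent en1 fin.
  by exists B; split => //; exact/ltW.
have G0 n k : 0 <= hausdorff_gauge s (G n k) by exact: hausdorff_gauge_ge0.
have /card_esym/ppcard_eqP[f] := card_nat2.
apply: (@le_trans _ _ (\sum_(k <oo) hausdorff_gauge s (uncurry G (f k)))).
  apply: ereal_inf_lbound => /=; exists (uncurry G \o f) => //; split.
    by move=> k /=; case: (f k) => a b /=; have [+ _ _] := PG a; exact.
  move=> t /AF[n _ Fnt]; have [_ /(_ _ Fnt)[k _ Gt] _] := PG n.
  by exists (f^-1%FUN (n, k)) => //=; rewrite invK ?inE.
rewrite nneseries_esumT; last by move=> k; case: (f k) => a b /=.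
rewrite -(@reindex_esum _ _ _ setT setT f
  (fun p => hausdorff_gauge s (uncurry G p)))//.
apply: (@le_trans _ _ (\sum_(n <oo) \sum_(k <oo) hausdorff_gauge s (G n k))).
  rewrite nneseries_esumT; last by move=> n; apply: nneseries_ge0.
  under [leRHS]eq_esum do rewrite nneseries_esumT//.
  rewrite esum_esum//; rewrite le_eqVlt; apply/orP; left; apply/eqP.
  have -> : setT `*`` (fun=> setT) = [set: nat * nat] by apply/seteqP; split.
  by apply: eq_esum => -[a b].
by apply: lee_nneseries => n *; [apply: nneseries_ge0|have [] := PG n].
Qed.

Lemma surface0 A : surface A set0 = 0.
Proof.
rewrite /surface set0I /hausdorff.
have H e : (0 < e)%R -> hausdorff_pre d.-1 e (set0 : set V) = 0.
  move=> e0; apply/eqP; rewrite eq_le hausdorff_pre_ge0 andbT.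
  apply: ereal_inf_lbound; exists (fun=> set0).
    split=> // k; rewrite ge_ereal_sup// => _ [->|[x []]//].
    by rewrite lee_fin ltW.
  by apply: eseries0 => k _ _; rewrite /hausdorff_gauge eqxx.
apply/eqP; rewrite eq_le; apply/andP; split.
  by apply: ge_ereal_sup => _ [e e0 <-]; rewrite H.
by apply: ereal_sup_ubound; exists 1%R => //=; rewrite H.
Qed.

Lemma surface_ge0 A B : 0 <= surface A B.
Proof.
apply: le_trans (hausdorff_pre_ge0 d.-1 1 (B `&` A)) _.
by apply: ereal_sup_ubound; exists 1%R => //=.
Qed.

Lemma surface_sub A B F : subset_sigma_subadditive (surface A) B F.
Proof.
move=> BF; apply: ge_ereal_sup => _ [e e0 <-].
apply: le_trans (hausdorff_pre_sub _ _ (F := fun n => F n `&` A) _) _.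
  by move=> x [/BF[n _ Fx] Ax]; exists n.
apply: lee_nneseries => n *; first exact: hausdorff_pre_ge0.
by apply: ereal_sup_ubound; exists e.
Qed.

HB.instance Definition _ (A : set V) := isSubsetOuterMeasure.Build R V (surface A)
  (surface0 A) (surface_ge0 A) (surface_sub A).

End Hausdorff.


(* The complement of A is null, so functions on the whole space modulo
   surface_measure A are functions on A modulo null sets. *)
Definition surface_outer (R : realType) (d : nat) (A : set 'rV[R]_d) :
  {outer_measure set 'rV[R]_d -> \bar R} := surface A.
Notation surfaceType A := (caratheodory_type (surface_outer A)).

Definition surface_measure (R : realType) (d : nat) (A : set 'rV[R]_d) :
    {measure set (surfaceType A) -> \bar R} :=
  [the measure _ _ of (surface_outer A : set (surfaceType A) -> \bar R)].

Local Open Scope quotient_scope.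

Section L2.
Context {disp : measure_display} {T : measurableType disp} {R : realType}.
Variable mu : {measure set T -> \bar R}.

Definition L2fun : Type := LfunType mu (@lee1n R 2).
HB.instance Definition _ := GRing.Lmodule.on L2fun.

Definition ae0 : {pred L2fun} := fun f => `[< {ae mu, forall x, f x = 0} >].

Lemma ae0_zmod_closed : zmod_closed ae0.
Proof.
split; first by apply/asboolP; apply: nearW.
move=> f g /asboolP f0 /asboolP g0; apply/asboolP.
by apply: filterS2 f0 g0 => x fx gx; transitivity (f x - g x) => //; rewrite fx gx subrr.
Qed.
HB.instance Definition _ := GRing.isZmodClosed.Build L2fun ae0 ae0_zmod_closed.

Definition L2 : Type := Quotient.quot ae0.
HB.instance Definition _ := Choice.on L2.
HB.instance Definition _ := GRing.Zmodule.on L2.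
HB.instance Definition _ := EqQuotient.on L2.
HB.instance Definition _ := ZmodQuotient.on L2.

Lemma L2_eqP (f g : L2fun) :
  \pi_L2 f = \pi_L2 g <-> {ae mu, forall x, f x = g x}.
Proof.
split=> [/eqP|fg].
  rewrite -Quotient.idealrBE => /asboolP; apply: filterS => x fgx.
  by apply/eqP; rewrite -subr_eq0; apply/eqP.
apply/eqP; rewrite -Quotient.idealrBE; apply/asboolP; apply: filterS fg => x fgx.
by transitivity (f x - g x) => //; rewrite fgx subrr.
Qed.

Lemma repr_ae (f : L2fun) : {ae mu, forall x, (repr (\pi_L2 f) : L2fun) x = f x}.
Proof. by apply/L2_eqP; rewrite reprK. Qed.

Definition L2_scale (c : R) (u : L2) : L2 := \pi_L2 (c *: repr u).

Lemma L2_scale_pi c f : L2_scale c (\pi_L2 f) = \pi_L2 (c *: f).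
Proof.
apply/L2_eqP; apply: filterS (repr_ae f) => x fx.
by transitivity (c * (repr (\pi_L2 f) : L2fun) x) => //; rewrite fx.
Qed.

Lemma L2_piD f g : \pi_L2 (f + g) = \pi_L2 f + \pi_L2 g :> L2.
Proof. exact: pi_addr. Qed.

Lemma L2_scaleA a b u : L2_scale a (L2_scale b u) = L2_scale (a * b) u.
Proof. by rewrite -[u]reprK (L2_scale_pi b) !L2_scale_pi scalerA. Qed.

Lemma L2_scale1 : left_id 1 L2_scale.
Proof. by move=> u; rewrite -[u]reprK L2_scale_pi scale1r. Qed.

Lemma L2_scaleDr : right_distributive L2_scale +%R.
Proof.
move=> c u v; rewrite -[u]reprK -[v]reprK -L2_piD !L2_scale_pi.
by rewrite scalerDr L2_piD.
Qed.

Lemma L2_scaleDl v : {morph L2_scale^~ v : a b / a + b}.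
Proof. by move=> a b; rewrite -[v]reprK !L2_scale_pi scalerDl L2_piD. Qed.

HB.instance Definition _ := GRing.Zmodule_isLmodule.Build R L2
  L2_scaleA L2_scale1 L2_scaleDr L2_scaleDl.


(* The class of f, or 0 when f is not square integrable. *)
Definition toL2 (f : T -> R) : L2 :=
  if pselect (f \in Lfun mu 2%:E) is left fL
  then \pi_L2 (Lfun_Sub (lee1n 2) fL : L2fun) else 0.

Definition L2_dot (u v : L2) : R :=
  (\int[mu]_x ((repr u : L2fun) x * (repr v : L2fun) x))%R.

Let L2_integrable (f g : L2fun) :
  mu.-integrable setT (EFin \o (fun x => f x * g x)).
Proof. by apply/Lfun1_integrable/Lfun2_mul_Lfun1; exact: LfunP. Qed.

Lemma L2_dot_pi (f g : L2fun) :
  L2_dot (\pi_L2 f) (\pi_L2 g) = (\int[mu]_x (f x * g x))%R.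
Proof.
rewrite /L2_dot /Rintegral; congr fine.
apply: ae_eq_integral => //.
- by have /integrableP[] := L2_integrable (repr (\pi_L2 f)) (repr (\pi_L2 g)).
- by have /integrableP[] := L2_integrable f g.
- by apply: filterS2 (repr_ae f) (repr_ae g) => x fx gx _ /=; rewrite fx gx.
Qed.

Lemma L2_dotC u v : L2_dot u v = L2_dot v u.
Proof. by apply: eq_Rintegral => x _; rewrite mulrC. Qed.

Lemma L2_dotDl u v w : L2_dot (u + v) w = L2_dot u w + L2_dot v w.
Proof.
rewrite -[u]reprK -[v]reprK -[w]reprK -L2_piD !L2_dot_pi.
rewrite -RintegralD//.
by apply: eq_Rintegral => x _; rewrite -mulrDl.
Qed.

Lemma L2_dotZl c u w : L2_dot (c *: u) w = c * L2_dot u w.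
Proof.
rewrite -[u]reprK -[w]reprK [_ *: _]L2_scale_pi !L2_dot_pi.
rewrite -RintegralZl//.
by apply: eq_Rintegral => x _; rewrite mulrA.
Qed.

Lemma L2_dot_ge0 u : 0 <= L2_dot u u.
Proof. by apply: Rintegral_ge0 => x _; exact: sqr_ge0. Qed.

Lemma L2_dot_eq0 u : L2_dot u u = 0 -> u = 0.
Proof.
rewrite -[u]reprK L2_dot_pi; set f := repr u => f0.
have -> : 0 = \pi_L2 0 :> L2 by rewrite -pi_zeror.
have := L2_integrable f f; set h := (X in _ \o X) => hint.
apply/L2_eqP.
have : (\int[mu]_x `|(EFin \o h) x| = 0)%E.
  under eq_integral => x _ do rewrite gee0_abs ?lee_fin ?sqr_ge0//.
  by rewrite -[LHS]fineK ?integrable_fin_num//; congr (_%:E).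
move/ae_eq_integral_abs => /(_ measurableT); case/integrableP : (hint) => mh _.
move=> /(_ mh); apply: filterS => x /(_ I) [] /eqP.
by rewrite mulf_eq0 orbb => /eqP.
Qed.

End L2.

Section L2sum.
Context {R : realType} {I : finType} {disp : I -> measure_display}.
Context {T : forall i, measurableType (disp i)}.
Variable mu : forall i, {measure set (T i) -> \bar R}.

Definition L2sum : Type := forall i, L2 (mu i).
Implicit Types u v w : L2sum.

HB.instance Definition _ := gen_eqMixin L2sum.
HB.instance Definition _ := gen_choiceMixin L2sum.

Definition L2sum_add u v : L2sum := fun i => u i + v i.
Definition L2sum_opp u : L2sum := fun i => - u i.
Definition L2sum_scale (c : R) u : L2sum := fun i => c *: u i.

Fact L2sum_addA : associative L2sum_add.
Proof. by move=> u v w; apply: functional_extensionality_dep => i; exact: addrA. Qed.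
Fact L2sum_addC : commutative L2sum_add.
Proof. by move=> u v; apply: functional_extensionality_dep => i; exact: addrC. Qed.
Fact L2sum_add0 : left_id (fun=> 0) L2sum_add.
Proof. by move=> u; apply: functional_extensionality_dep => i; exact: add0r. Qed.
Fact L2sum_addN : left_inverse (fun=> 0) L2sum_opp L2sum_add.
Proof. by move=> u; apply: functional_extensionality_dep => i; exact: addNr. Qed.
HB.instance Definition _ := GRing.isZmodule.Build L2sum
  L2sum_addA L2sum_addC L2sum_add0 L2sum_addN.

Fact L2sum_scaleA a b u : L2sum_scale a (L2sum_scale b u) = L2sum_scale (a * b) u.
Proof. by apply: functional_extensionality_dep => i; exact: scalerA. Qed.
Fact L2sum_scale1 : left_id 1 L2sum_scale.
Proof. by move=> u; apply: functional_extensionality_dep => i; exact: scale1r. Qed.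
Fact L2sum_scaleDr : right_distributive L2sum_scale +%R.
Proof. by move=> a u v; apply: functional_extensionality_dep => i; exact: scalerDr. Qed.
Fact L2sum_scaleDl u : {morph L2sum_scale^~ u : a b / a + b}.
Proof. by move=> a b; apply: functional_extensionality_dep => i; exact: scalerDl. Qed.
HB.instance Definition _ := GRing.Zmodule_isLmodule.Build R L2sum
  L2sum_scaleA L2sum_scale1 L2sum_scaleDr L2sum_scaleDl.

Definition L2sum_dot u v : R := \sum_i L2_dot (u i) (v i).

Fact L2sum_dot_bilinear : bilinear_for *%R (idfun \; *%R) L2sum_dot.
Proof.
split=> [w a u v|w a u v] /=; rewrite /L2sum_dot mulr_sumr -big_split /=;
  apply: eq_bigr => i _; last rewrite L2_dotC (L2_dotC (w i)) (L2_dotC (w i)).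
- by rewrite -L2_dotZl -L2_dotDl.
- by rewrite -L2_dotZl -L2_dotDl.
Qed.
HB.instance Definition _ := bilinear_isBilinear.Build R L2sum L2sum R
  *%R (idfun \; *%R) L2sum_dot L2sum_dot_bilinear.


Lemma L2sum_dotC u v : L2sum_dot u v = L2sum_dot v u.
Proof. by apply: eq_bigr => i _; exact: L2_dotC. Qed.

Fact L2sum_dot_hermitian u v :
  L2sum_dot u v = (-1) ^+ false * idfun (L2sum_dot v u).
Proof. by rewrite mul1r; exact: L2sum_dotC. Qed.
HB.instance Definition _ := isHermitianSesquilinear.Build R L2sum false idfun
  L2sum_dot L2sum_dot_hermitian.

Lemma L2sum_dot_ge0 u : 0 <= L2sum_dot u u.
Proof. by apply: sumr_ge0 => i _; exact: L2_dot_ge0. Qed.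

Lemma L2sum_dot_eq0 u : L2sum_dot u u = 0 -> u = 0.
Proof.
move/eqP; rewrite psumr_eq0; last by move=> i _; exact: L2_dot_ge0.
move=> /allP u0; apply: functional_extensionality_dep => i.
by apply/L2_dot_eq0/eqP/(implyP (u0 i _)) => //; exact: mem_index_enum.
Qed.

Fact L2sum_dot_gt0 u : u != 0 -> 0 < L2sum_dot u u.
Proof.
move=> u0; rewrite lt_def L2sum_dot_ge0 andbT.
by apply: contra_neq u0; exact: L2sum_dot_eq0.
Qed.
HB.instance Definition _ := isDotProduct.Build R L2sum L2sum_dot L2sum_dot_gt0.

Definition L2sum_norm u : R := Num.sqrt (L2sum_dot u u).

Lemma L2sum_CauchySchwarz u v :
  L2sum_dot u v ^+ 2 <= L2sum_dot u u * L2sum_dot v v.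
Proof.
have [->|v0] := eqVneq v 0.
  have d0 w : L2sum_dot w 0 = 0 by exact: linear0r.
  by rewrite !d0 expr0n mulr0.
have vv := L2sum_dot_gt0 v0; set a := L2sum_dot v v in vv *.
set b := L2sum_dot u v.
have := L2sum_dot_ge0 (a *: u - b *: v).
rewrite linearBl !linearBr /= !linearZl_LR !linearZr_LR /= -/a -/b (L2sum_dotC v u) -/b.
set c := L2sum_dot u u => h.
have : 0 <= a * (c * a - b ^+ 2).
  by apply: le_trans h _; rewrite le_eqVlt; apply/orP; left; apply/eqP; rewrite /=; ring.
by rewrite pmulr_rge0// subr_ge0.
Qed.

Fact L2sum_normD u v : L2sum_norm (u + v) <= L2sum_norm u + L2sum_norm v.
Proof.
rewrite -ler_sqr ?nnegrE ?addr_ge0 ?sqrtr_ge0// sqrrD !sqr_sqrtr ?L2sum_dot_ge0//.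
rewrite linearDl !linearDr /= (L2sum_dotC v u) !addrA lerD2r -!addrA lerD2l.
rewrite -mulr2n lerMn2r/= /L2sum_norm -sqrtrM ?L2sum_dot_ge0//.
by apply: le_trans (ler_norm _) _; rewrite -sqrtr_sqr ler_wsqrtr// L2sum_CauchySchwarz.
Qed.

Fact L2sum_normZ c u : L2sum_norm (c *: u) = `|c| * L2sum_norm u.
Proof.
rewrite /L2sum_norm linearZl_LR linearZr_LR/= mulrA -expr2 sqrtrM ?sqr_ge0//.
by rewrite sqrtr_sqr.
Qed.

Fact L2sum_norm_eq0 u : L2sum_norm u = 0 -> u = 0.
Proof.
move/eqP; rewrite sqrtr_eq0 => u0; apply: L2sum_dot_eq0.
by apply/eqP; rewrite eq_le u0 L2sum_dot_ge0.
Qed.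

HB.instance Definition _ := Lmodule_isNormed.Build R L2sum
  L2sum_normD L2sum_normZ L2sum_norm_eq0.

End L2sum.
Local Close Scope quotient_scope.

Section OperatorsOnSubspaces.
Context {R : realType} {E : normedModType R}.
Implicit Types (V : set E) (T : E -> E).

Definition finite_dim_subspace V := exists (m : nat) (b : 'I_m -> E),
  V = [set \sum_i c i *: b i | c in [set: 'I_m -> R]].

(* On a T which is unbounded on V, sup returns 0. *)
Definition opnorm V T : R := sup [set `|T u| | u in [set u | V u /\ `|u| <= 1]].

(* T is a bijection of V onto itself whose inverse is bounded. *)
Definition invertible_on V T :=
  set_bij V V T /\ exists M : R, forall u, V u -> `|u| <= M * `|T u|.

Definition opinv V T : E -> E := 'pinv_(fun=> 0) V T.

End OperatorsOnSubspaces.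

Section EllipticProblems.
Context {R : realType}.

(* For an open D in finite dimension, continuity of the iterated directional
   derivatives amounts to continuity of the partial derivatives. *)
Fixpoint Ck {W : normedModType R} (k : nat) (D : set W) (f : W -> R) : Prop :=
  (forall x, D x -> {for x, continuous f}) /\
  if k is k'.+1 then
    forall v, (forall x, D x -> derivable f x v) /\ Ck k' D ('D_v f)
  else True.

Context {d : nat}.
Notation V := 'rV[R]_d.

Definition bdry (D : set V) : set V := closure D `\` interior D.

Record diff_op2 := DiffOp2 {
  coef2 : 'I_d -> 'I_d -> V -> R ;
  coef1 : 'I_d -> V -> R ;
  coef0 : V -> R }.

Definition partial (i : 'I_d) (u : V -> R) : V -> R := 'D_(delta_mx 0 i) u.

Definition apply_op (A : diff_op2) (u : V -> R) : V -> R := fun x =>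
  \sum_i \sum_j coef2 A i j x * partial i (partial j u) x +
  \sum_i coef1 A i x * partial i u x + coef0 A x * u x.

Definition elliptic (A : diff_op2) (D : set V) := forall x, D x ->
  forall xi : V, xi != 0 ->
    \sum_i \sum_j coef2 A i j x * xi 0 i * xi 0 j != 0.

Definition dirichlet_solution (A : diff_op2) (D : set V) (f g u : V -> R) :=
  [/\ Ck 2 D u, {within closure D, continuous u},
      forall x, D x -> apply_op A u x = f x &
      forall x, bdry D x -> u x = g x].

(* Solutions are classical, in C^2(D) and continuous on closure D; the data are
   a smooth right-hand side f and a continuous boundary value g. *)
Definition uniquely_solvable (A : diff_op2) (D : set V) := forall f g : V -> R,
  (forall k, Ck k setT f) -> {within bdry D, continuous g} ->
  exists2 u, dirichlet_solution A D f g u &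
    forall v, dirichlet_solution A D f g v -> {in closure D, v =1 u}.

Definition poisson_kernel (A : diff_op2) (D : set V) (G : V -> V -> R) :=
  forall phi : V -> R, {within bdry D, continuous phi} ->
  exists2 v, dirichlet_solution A D (cst 0) phi v &
    forall x, D x ->
      (surface_measure (bdry D)).-integrable setT
        (fun y => (G x y * phi y)%:E) /\
      v x = (\int[surface_measure (bdry D)]_y (G x y * phi y))%R.

(* G is only meaningful on D * bdry D; it is C^k up to the closure and away
   from the diagonal when it locally extends to C^k functions. *)
Definition smooth_off_diagonal (k : nat) (D : set V) (G : V -> V -> R) :=
  forall x y, closure D x -> bdry D y -> x != y ->
  exists (W : set (V * V)) (g : V * V -> R),
    [/\ open W, W (x, y), Ck k W g &
        forall q, W q -> D q.1 -> bdry D q.2 -> g q = G q.1 q.2].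

End EllipticProblems.
Arguments diff_op2 : clear implicits.

Section Slabs.
Context {R : realType} {d : nat}.
Variables (Omega : set 'rV[R]_d) (nu : 'rV[R]_d) (a H : R).

Definition slab (i : nat) : set 'rV[R]_d :=
  Omega `&` [set x | a + i%:R * H < edot nu x < a + i.+1%:R * H].

Definition interface (j : nat) : set 'rV[R]_d :=
  Omega `&` [set x | edot nu x = a + j%:R * H].

Definition double_slab (j : nat) : set 'rV[R]_d :=
  slab j.-1 `|` interface j `|` slab j.

Definition slab_tessellation (N : nat) :=
  [/\ enorm nu = 1, 0 < H, forall i, (i <= N)%N -> slab i !=set0 &
      Omega = \bigcup_(i in [set i | (i <= N)%N]) slab i `|`
              \bigcup_(j in [set j | (0 < j <= N)%N]) interface j].

(* The ordinal j : 'I_N stands for the interface of index j.+1. *)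
Definition trace_space (N : nat) : Type :=
  L2sum (fun j : 'I_N => surface_measure (interface j.+1)).
HB.instance Definition _ N := NormedModule.on (trace_space N).

Definition transfer (A B : set 'rV[R]_d) (G : 'rV[R]_d -> 'rV[R]_d -> R)
    (phi : L2 (surface_measure B)) : L2 (surface_measure A) :=
  toL2 (surface_measure A) (fun x =>
    (\int[surface_measure B]_y
       (G x y * (repr phi : L2fun (surface_measure B)) y))%R).

Context {N : nat}.
Implicit Types (G : 'I_N -> 'rV[R]_d -> 'rV[R]_d -> R) (u : trace_space N).

Definition equilibrium_K G u : trace_space N := fun j =>
  \sum_(i < N | (i.+1 == j) || (j.+1 == i))
    transfer (interface j.+1) (G j) (u i).

Definition equilibrium_S G u : trace_space N := u - equilibrium_K G u.

(* The default 0 is never used when V is a finite-dimensional subspace. *)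
Definition orth_proj (V : set (trace_space N)) u : trace_space N :=
  xget 0 [set p | V p /\ forall w, V w -> L2sum_dot (u - p) w = 0].

Definition projected_S G (V : set (trace_space N)) u : trace_space N :=
  u - orth_proj V (equilibrium_K G u).

Definition extended_S G (V : set (trace_space N)) u : trace_space N :=
  u - orth_proj V (equilibrium_K G (orth_proj V u)).

End Slabs.
Arguments trace_space {R d} Omega nu a H N.
Arguments equilibrium_K {R d} Omega nu a H {N} G u.
Arguments equilibrium_S {R d} Omega nu a H {N} G u.
Arguments projected_S {R d} Omega nu a H {N} G V u.
Arguments extended_S {R d} Omega nu a H {N} G V u.

(* Main.v *)
From HB Require Import structures.
Require Import Defs.
From mathcomp Require Import all_boot all_order all_algebra.
From mathcomp Require Import ring lra.
From mathcomp Require Import all_classical all_reals all_analysis.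
From mathcomp Require Import measurable_realfun.
Set Implicit Arguments.
Unset Strict Implicit.
Unset Printing Implicit Defensive.
Import Order.TTheory GRing.Theory Num.Theory.
Import numFieldNormedType.Exports.
Local Open Scope classical_set_scope.
Local Open Scope ring_scope.

(** The whole statement rests on one analytic fact: the equilibrium operator K
    is a limit, in operator norm, of operators of finite rank.

    Why K has this property.  Each block of K is an integral operator whose
    kernel G_j is read on the product of two distinct interfaces.  The closures
    of these interfaces are compact and disjoint and G_j extends continuously to
    a neighbourhood of every point of their product, so finitely many rectangles
    on which G_j oscillates by at most e cover the product.  Hence G_j is
    uniformly within e of a finite combination of indicators of rectangles
    ([smooth_kernel_step_limit]).  Such a step kernel gives an operator of finite
    rank, and by the Cauchy-Schwarz inequality replacing G_j by a step kernel
    costs at most e times a constant in operator norm ([kernel_op_close]).  Two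
    facts on the Hausdorff measure are needed: balls are measurable, because the
    measure is additive on sets at positive distance
    ([surface_measurable_ball]), and an interface has finite measure, because it
    is a bounded piece of a hyperplane ([hyperplane_piece_finite]).

    Why this is enough.  If F is the sum of the u |-> <u, b> a over finitely many
    pairs (a, b), then F - P_n F P_n is controlled by the distances |a - P_n a|
    and |b - P_n b|, which tend to 0 because the X_n are nested with dense union.
    Passing to the limit, P_n K P_n tends to K in norm ([compression_cvg]), i.e.
    the gap between Sbar_n and S tends to 0.  As soon as |S^-1| gap < 1, the
    reverse triangle inequality bounds Sbar_n from below with the announced
    constant ([perturbed_lower_bound]).

    Surjectivity needs neither completeness nor a Neumann series.  For v in X_n
    and w orthogonal to X_n one has Sbar_n (v + w) = S_n v + w.  Thus S_n is an
    injective endomorphism of the finite-dimensional space X_n, hence onto, and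
    then so is Sbar_n ([compressed_invertible]).  The same identity shows that
    the inverse of S_n is the restriction of the inverse of Sbar_n to X_n, which
    is the comparison of their norms. *)

(** * Operator norms and inverses *)

Section OperatorNorms.
Context {R : realType} {E : normedModType R}.
Implicit Types (V : set E) (T : E -> E).

Definition subspace V := V 0 /\ forall c u v, V u -> V v -> V (c *: u + v).

Lemma subspaceT : subspace [set: E]. Proof. by []. Qed.

Lemma subspaceZ V c u : subspace V -> V u -> V (c *: u).
Proof. by move=> [V0 VD] Vu; rewrite -[_ *: _]addr0; exact: VD. Qed.

Lemma subspaceB V u v : subspace V -> V u -> V v -> V (u - v).
Proof. by move=> [_ VD] Vu Vv; rewrite addrC -scaleN1r; exact: VD. Qed.

Lemma opnorm_le V T (M : R) : V 0 -> 0 <= M ->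
  (forall u, V u -> `|T u| <= M * `|u|) -> opnorm V T <= M.
Proof.
move=> V0 M0 TM; apply: ge_sup.
  by exists `|T 0|; exists 0 => //; split=> //; rewrite normr0.
move=> _ [u [Vu u1] <-]; apply: le_trans (TM _ Vu) _.
by rewrite ler_piMr.
Qed.

(** The a priori bound M makes the set of the `|T u|` bounded; for an unbounded
    T the supremum defining [opnorm] would be 0 and the conclusion false. *)
Lemma le_opnorm V T (M : R) : subspace V ->
  (forall c u, V u -> T (c *: u) = c *: T u) ->
  (forall u, V u -> `|T u| <= M * `|u|) ->
  forall u, V u -> `|T u| <= opnorm V T * `|u|.
Proof.
move=> sV TZ TM u Vu; have [->|u0] := eqVneq u 0.
  have -> : T 0 = 0 by have := TZ 0 u Vu; rewrite !scale0r.
  by rewrite normr0 mulr0.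
have nu : 0 < `|u| by rewrite normr_gt0.
rewrite -ler_pdivrMr//.
have -> : `|T u| / `|u| = `|T (`|u|^-1 *: u)|.
  by rewrite TZ// normrZ ger0_norm ?invr_ge0// mulrC.
apply: ub_le_sup; last first.
  exists (`|u|^-1 *: u) => //; split; first exact: subspaceZ.
  by rewrite normrZ ger0_norm ?invr_ge0// mulVf// gt_eqF.
exists `|M| => _ [w [Vw w1] <-]; apply: le_trans (TM _ Vw) _.
apply: le_trans (ler_wpM2r _ (ler_norm M)) _ => //.
by rewrite ler_piMr.
Qed.

Lemma opnorm_ge0 V T : V 0 -> 0 <= opnorm V T.
Proof.
move=> V0; have [hs|hs] := pselect (has_sup
    [set `|T u| | u in [set u | V u /\ `|u| <= 1]]).
  apply: le_trans (normr_ge0 (T 0)) _; apply: ub_le_sup; first by case: hs.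
  by exists 0 => //; split=> //; rewrite normr0.
by rewrite /opnorm sup_out.
Qed.

Lemma linear_map0 T : linear T -> T 0 = 0.
Proof. by move=> linT; have := linT (-1) 0 0; rewrite scaler0 addr0 scaleN1r addNr. Qed.

Lemma linear_mapZ T c u : linear T -> T (c *: u) = c *: T u.
Proof. by move=> linT; rewrite -[c *: u]addr0 linT linear_map0// addr0. Qed.

Lemma linear_mapB T u v : linear T -> T (u - v) = T u - T v.
Proof. by move=> linT; rewrite addrC -scaleN1r linT scaleN1r addrC. Qed.

Lemma linear_combination T (I : Type) (r : seq I) (c : I -> R) (e : I -> E) :
  linear T -> T (\sum_(i <- r) c i *: e i) = \sum_(i <- r) c i *: T (e i).
Proof.
move=> linT; elim: r => [|i r IH]; first by rewrite !big_nil linear_map0.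
by rewrite !big_cons linT IH.
Qed.

Section Inverse.
Variables (V : set E) (T : E -> E).
Hypotheses (sV : subspace V) (TV : invertible_on V T).

Lemma opinv_in v : V v -> V (opinv V T v).
Proof.
by move=> Vv; have [bij _] := TV; have [+ _ _] := bijpinv_bij (fun=> 0) bij; apply.
Qed.

Lemma opinvK v : V v -> T (opinv V T v) = v.
Proof.
by move=> Vv; have [[_ _ surj] _] := TV; apply: (surjpK (fun=> 0) surj); rewrite inE.
Qed.

Lemma opinv_unique u : V u -> opinv V T (T u) = u.
Proof.
by move=> Vu; have [[_ inj _] _] := TV; apply: (pinvKV (fun=> 0) inj); rewrite inE.
Qed.

Lemma le_opnorm_opinv : linear T ->
  forall v, V v -> `|opinv V T v| <= opnorm V (opinv V T) * `|v|.
Proof.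
move=> linT; have [_ [M TM]] := TV.
apply: (@le_opnorm _ _ M) => // [c u Vu|u Vu]; last first.
  by rewrite -{2}[u]opinvK//; apply: TM; exact: opinv_in.
rewrite -[in LHS](opinvK Vu) -linear_mapZ// opinv_unique//.
by apply: subspaceZ => //; exact: opinv_in.
Qed.

End Inverse.

(** From S u = B u - (B u - S u) one gets |u| <= sigma |S u| <=
    sigma (|B u| + g |u|), where sigma is the norm of the inverse of S; the term
    in |u| is absorbed on the left because sigma g < 1. *)
Lemma perturbed_lower_bound (S B : E -> E) (g : R) : linear S -> invertible_on setT S ->
  (forall u, `|B u - S u| <= g * `|u|) -> opnorm setT (opinv setT S) * g < 1 ->
  forall u, `|u| <=
    opnorm setT (opinv setT S) / (1 - opnorm setT (opinv setT S) * g) * `|B u|.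
Proof.
move=> linS invS BS; set sigma := opnorm _ _ => sg u.
have sigma0 : 0 <= sigma by exact: opnorm_ge0.
rewrite mulrAC ler_pdivlMr ?subr_gt0// mulrBr mulr1 lerBlDr.
have := le_opnorm_opinv subspaceT invS linS (v := S u) I.
rewrite opinv_unique// -/sigma => /le_trans; apply.
rewrite [_ * (_ * g)]mulrC -mulrA -mulrDr ler_wpM2l//.
rewrite -[S u](subKr (B u)); apply: le_trans (ler_normB _ _) _.
by rewrite lerD2l.
Qed.

Lemma opnorm_opinv_le V T (M : R) : subspace V -> invertible_on V T -> 0 <= M ->
  (forall u, V u -> `|u| <= M * `|T u|) -> opnorm V (opinv V T) <= M.
Proof.
move=> sV invT M0 TM; apply: opnorm_le => //; first by case: sV.
by move=> u Vu; rewrite -{2}(opinvK invT Vu); apply: TM; exact: opinv_in.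
Qed.

End OperatorNorms.

(** * Inner products and projections *)

Section InnerProduct.
Context {R : realType} {E : normedModType R}.
Implicit Types (V : set E) (T : E -> E) (u v w : E).

(** The inner product is a parameter compatible with a given norm, so that the
    results apply to a normed module that already carries its topology. *)
Record inner_product (dot : E -> E -> R) : Prop := {
  dotC : forall u v, dot u v = dot v u ;
  dotDl : forall u v w, dot (u + v) w = dot u w + dot v w ;
  dotZl : forall c u w, dot (c *: u) w = c * dot u w ;
  norm_dot : forall u, `|u| ^+ 2 = dot u u }.

Variable dot : E -> E -> R.
Hypothesis dotP : inner_product dot.

Let dotDl u v w : dot (u + v) w = dot u w + dot v w. Proof. exact: dotDl. Qed.
Let dotZl c u w : dot (c *: u) w = c * dot u w. Proof. exact: dotZl. Qed.
Let dotC u v : dot u v = dot v u. Proof. exact: dotC. Qed.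
Let normE u : `|u| ^+ 2 = dot u u. Proof. exact: norm_dot. Qed.

Lemma dotDr u v w : dot w (u + v) = dot w u + dot w v.
Proof. by rewrite dotC dotDl !(dotC w). Qed.

Lemma dotZr c u w : dot w (c *: u) = c * dot w u.
Proof. by rewrite dotC dotZl (dotC w). Qed.

Lemma dot0l u : dot 0 u = 0.
Proof. by rewrite -(scale0r 0) dotZl mul0r. Qed.

Lemma dotBl u v w : dot (u - v) w = dot u w - dot v w.
Proof. by rewrite dotDl -scaleN1r dotZl mulN1r. Qed.

Lemma dotBr u v w : dot w (u - v) = dot w u - dot w v.
Proof. by rewrite dotC dotBl !(dotC w). Qed.

Lemma dot_eq0 u : dot u u = 0 -> u = 0.
Proof. by rewrite -normE => /eqP; rewrite sqrf_eq0 normr_eq0 => /eqP. Qed.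

Lemma dot_suml (I : Type) (r : seq I) (F : I -> E) w :
  dot (\sum_(i <- r) F i) w = \sum_(i <- r) dot (F i) w.
Proof.
elim: r => [|i r IH]; first by rewrite !big_nil dot0l.
by rewrite !big_cons dotDl IH.
Qed.

(** Expand the square of the norm of <v, v> u - <u, v> v. *)
Lemma CauchySchwarz u v : `|dot u v| <= `|u| * `|v|.
Proof.
have [->|v0] := eqVneq v 0; first by rewrite dotC dot0l !normr0 mulr0.
have nv : 0 < dot v v by rewrite -normE exprn_gt0// normr_gt0.
rewrite -ler_sqr ?nnegrE ?mulr_ge0// exprMn !normE real_normK ?num_real//.
have := sqr_ge0 `|dot v v *: u - dot u v *: v|.
rewrite normE !dotBl !dotBr !dotZl !dotZr (dotC v u).
rewrite (_ : _ - _ = dot v v * (dot u u * dot v v - dot u v ^+ 2)); last by ring.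
by rewrite pmulr_rge0// subr_ge0.
Qed.

Section Projections.

Definition span m (e : 'I_m -> E) : set E :=
  [set \sum_i c i *: e i | c in [set: 'I_m -> R]].

Lemma span_subspace m (e : 'I_m -> E) : subspace (span e).
Proof.
split=> [|c _ _ [a _ <-] [b _ <-]].
  by exists (fun=> 0) => //; rewrite big1// => i _; rewrite scale0r.
exists (fun i => c * a i + b i) => //.
rewrite scaler_sumr -big_split; apply: eq_bigr => i _.
by rewrite scalerDl scalerA.
Qed.

Lemma mem_span m (e : 'I_m -> E) i : span e (e i).
Proof.
exists (fun j => (j == i)%:R) => //; rewrite (bigD1 i)//= eqxx scale1r.
by rewrite big1 ?addr0// => j /negPf ->; rewrite scale0r.
Qed.

Lemma subspace_sum V (I : Type) (r : seq I) (c : I -> R) (e : I -> E) :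
  subspace V -> (forall i, V (e i)) -> V (\sum_(i <- r) c i *: e i).
Proof.
move=> sV Ve; elim: r => [|i r IH]; first by rewrite big_nil; case: sV.
by rewrite big_cons; apply: sV.2.
Qed.

Lemma span_le m (e : 'I_m -> E) V :
  subspace V -> (forall i, V (e i)) -> span e `<=` V.
Proof. by move=> sV Ve _ [c _ <-]; exact: subspace_sum. Qed.

Definition orthonormal m (e : 'I_m -> E) :=
  forall i j, dot (e i) (e j) = (i == j)%:R.

Lemma orthonormal_coord m (e : 'I_m -> E) (c : 'I_m -> R) j :
  orthonormal e -> dot (\sum_i c i *: e i) (e j) = c j.
Proof.
move=> oe; rewrite dot_suml (bigD1 j)//= dotZl oe eqxx mulr1 big1 ?addr0//.
by move=> i /negPf ij; rewrite dotZl oe ij mulr0.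
Qed.

(** The sum of the <u, e_i> e_i is therefore the orthogonal projection of u on
    the span of e. *)
Lemma orthonormal_residual m (e : 'I_m -> E) u j : orthonormal e ->
  dot (u - \sum_i dot u (e i) *: e i) (e j) = 0.
Proof. by move=> oe; rewrite dotBl orthonormal_coord// subrr. Qed.

(** Gram-Schmidt: the residual of each new generator is dropped when it
    vanishes and normalised otherwise. *)
Lemma orthonormal_basis V : finite_dim_subspace V ->
  exists m (e : 'I_m -> E), orthonormal e /\ V = span e.
Proof.
move=> [m [b ->]]; rewrite -/(span b).
elim: m b => [|m IH] b; first by exists 0, b; split=> // -[].
have [n [e [oe eb]]] := IH (fun i => b (lift ord0 i)).
pose s := \sum_i dot (b ord0) (e i) *: e i.
pose r := b ord0 - s.
have sub_b i : span e (b (lift ord0 i)).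
  by rewrite -eb; exact: (mem_span (fun i => b (lift ord0 i))).
have sub_e i : span b (e i).
  have : span e (e i) by exact: mem_span.
  rewrite -eb; apply: span_le => [|j]; [exact: span_subspace|exact: mem_span].
have span_s : span b s by apply: subspace_sum => //; exact: span_subspace.
have [r0|r0] := eqVneq r 0.
  exists n, e; split=> //; apply/seteqP; split; apply: span_le => //;
    try exact: span_subspace.
  move=> i; case: (unliftP ord0 i) => [j|] -> //.
  have -> : b ord0 = s by apply/eqP; rewrite -subr_eq0; apply/eqP.
  by exists (fun i => dot (b ord0) (e i)).
pose f (i : 'I_n.+1) := if unlift ord0 i is Some j then e j else `|r|^-1 *: r.
have f0 : f ord0 = `|r|^-1 *: r by rewrite /f unlift_none.
have fl j : f (lift ord0 j) = e j by rewrite /f liftK.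
have re j : dot r (e j) = 0 by exact: orthonormal_residual.
exists n.+1, f; split.
  move=> i j; case: (unliftP ord0 i) => [i'|] ->;
      case: (unliftP ord0 j) => [j'|] ->; rewrite ?f0 ?fl.
  - by rewrite oe (inj_eq lift_inj).
  - by rewrite dotC dotZl re mulr0 eq_sym.
  - by rewrite dotZl re mulr0.
  - by rewrite dotZl dotZr -normE eqxx mulrA -expr2 -exprMn mulVf ?expr1n ?normr_eq0.
have ef i : span f (e i) by rewrite -fl; exact: mem_span.
have sf := span_subspace f.
apply/seteqP; split; apply: span_le => //.
- move=> i; case: (unliftP ord0 i) => [j|] ->.
    by move: (sub_b j); apply: span_le.
  have -> : b ord0 = `|r| *: f ord0 + s.
    by rewrite f0 scalerA mulfV ?normr_eq0// scale1r subrK.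
  by apply: sf.2; [exact: mem_span|exact: subspace_sum].
- exact: span_subspace.
- move=> i; case: (unliftP ord0 i) => [j|] ->; rewrite ?f0 ?fl//.
  apply: subspaceZ; first exact: span_subspace.
  by apply: subspaceB => //; [exact: span_subspace|exact: mem_span].
Qed.

Lemma finite_dim_is_subspace V : finite_dim_subspace V -> subspace V.
Proof. by move=> [m [b ->]]; exact: span_subspace. Qed.

Definition orthogonal_projection V (P : E -> E) :=
  forall u, V (P u) /\ forall w, V w -> dot (u - P u) w = 0.

Lemma projection_exists V u : finite_dim_subspace V ->
  exists p, V p /\ forall w, V w -> dot (u - p) w = 0.
Proof.
move=> /orthonormal_basis [m [e [oe ->]]].
exists (\sum_i dot u (e i) *: e i); split; first by exists (fun i => dot u (e i)).
move=> _ [c _ <-]; rewrite dotC dot_suml big1// => i _.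
by rewrite dotZl dotC orthonormal_residual// mulr0.
Qed.

(** In an orthonormal basis T is the right multiplication of coordinate rows by
    a square matrix A, and a nonzero row annihilated by A would contradict
    injectivity. *)
Lemma injective_surjective V T : finite_dim_subspace V -> linear T ->
  (forall v, V v -> V (T v)) -> (forall v, V v -> T v = 0 -> v = 0) ->
  forall w, V w -> exists2 v, V v & T v = w.
Proof.
move=> /orthonormal_basis [m [e [oe ->]]] linT TV T_inj _ [c _ <-].
pose A : 'M[R]_m := \matrix_(i, j) dot (T (e i)) (e j).
have Te i : T (e i) = \sum_j A i j *: e j.
  have [a _ aE] := TV _ (mem_span e i).
  rewrite -aE; apply: eq_bigr => j _; rewrite mxE -aE orthonormal_coord//.
have TE (a : 'rV[R]_m) :
    T (\sum_i a 0 i *: e i) = \sum_j (a *m A) 0 j *: e j.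
  have -> : T (\sum_i a 0 i *: e i) = \sum_i a 0 i *: T (e i).
    exact: linear_combination.
  under eq_bigr do rewrite Te scaler_sumr.
  rewrite exchange_big; apply: eq_bigr => j _ /=; rewrite mxE scaler_suml.
  by apply: eq_bigr => i _; rewrite scalerA.
have Au : A \in unitmx.
  rewrite unitmxE unitfE; apply/negP => /det0P [a a0 aA].
  have ae : \sum_i a 0 i *: e i = 0.
    apply: T_inj; first by exists (a 0).
    by rewrite TE aA big1// => j _; rewrite mxE scale0r.
  case/eqP: a0; apply/rowP => j; rewrite mxE.
  by rewrite -(orthonormal_coord (a 0) j oe) ae dot0l.
pose a := (\row_j c j) *m invmx A.
exists (\sum_i a 0 i *: e i); first by exists (a 0).
by rewrite TE mulmxKV//; apply: eq_bigr => j _; rewrite mxE.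
Qed.

Section Projection.
Variables (V : set E) (P : E -> E).
Hypotheses (sV : subspace V) (PV : orthogonal_projection V P).

Lemma proj_in u : V (P u). Proof. exact: (PV u).1. Qed.

Lemma proj_orth u w : V w -> dot (u - P u) w = 0.
Proof. exact: (PV u).2. Qed.

(** The difference of two candidates lies in V and is orthogonal to V. *)
Lemma proj_unique u p : V p -> (forall w, V w -> dot (u - p) w = 0) -> P u = p.
Proof.
move=> Vp up; apply/eqP; rewrite -subr_eq0; apply/eqP/dot_eq0.
have Vd : V (P u - p) by apply: subspaceB => //; exact: proj_in.
have -> : dot (P u - p) (P u - p) = dot (u - p - (u - P u)) (P u - p).
  by congr dot; rewrite opprB [RHS]addrC addrA subrK.
by rewrite dotBl up// proj_orth// subrr.
Qed.

Lemma proj_id u : V u -> P u = u.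
Proof. by move=> Vu; apply: proj_unique => // w _; rewrite subrr dot0l. Qed.

Lemma proj_linear : linear P.
Proof.
move=> c u v; apply: proj_unique; first by apply: sV.2; exact: proj_in.
move=> w Vw.
rewrite (_ : _ - _ = c *: (u - P u) + (v - P v)).
  by rewrite dotDl dotZl !proj_orth// mulr0 addr0.
by rewrite scalerBr opprD addrACA.
Qed.

Lemma norm_proj_sqr u : `|u| ^+ 2 = `|P u| ^+ 2 + `|u - P u| ^+ 2.
Proof.
rewrite -[in LHS](subrK (P u) u) !normE !(dotDr (u - P u)) !(dotDl (u - P u)).
by rewrite (dotC (P u) (u - P u)) (proj_orth _ (proj_in u)) addr0 add0r addrC.
Qed.

Lemma norm_proj u : `|P u| <= `|u|.
Proof. by rewrite -ler_sqr ?nnegrE// (norm_proj_sqr u) lerDl sqr_ge0. Qed.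

Lemma proj_adjoint u v : dot (P u) v = dot u (P v).
Proof.
rewrite -[v in LHS](subrK (P v)) -[u in RHS](subrK (P u)) dotDl (dotDr (v - P v)).
by rewrite [dot (P u) (v - P v)]dotC !proj_orth//; exact: proj_in.
Qed.

Lemma proj_best u w : V w -> `|u - P u| <= `|u - w|.
Proof.
move=> Vw; rewrite -ler_sqr ?nnegrE// (norm_proj_sqr (u - w)).
have linP := proj_linear.
have -> : P (u - w) = P u - w.
  by rewrite addrC -scaleN1r linP proj_id// scaleN1r addrC.
by rewrite opprB addrA subrK lerDr sqr_ge0.
Qed.

End Projection.
End Projections.

(** * Norm limits of finite-rank operators *)

Section FiniteRank.

Definition rank_op (s : seq (E * E)) u : E := \sum_(p <- s) dot u p.2 *: p.1.

(** On a Hilbert space these are the compact operators.  Neither linearity nor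
    boundedness of T is part of the definition: both are inherited from the
    approximating operators. *)
Definition finite_rank_limit T := forall eps : R, 0 < eps ->
  exists s, forall u, `|T u - rank_op s u| <= eps * `|u|.

Lemma rank_op_linear s : linear (rank_op s).
Proof.
move=> c u v; rewrite /rank_op scaler_sumr -big_split; apply: eq_bigr => p _ /=.
by rewrite dotDl dotZl scalerDl scalerA.
Qed.

Lemma rank_op_bounded s u :
  `|rank_op s u| <= (\sum_(p <- s) `|p.2| * `|p.1|) * `|u|.
Proof.
rewrite mulr_suml; apply: le_trans (ler_norm_sum _ _ _) _.
apply: ler_sum => p _; rewrite normrZ mulrAC ler_wpM2r//.
by rewrite (mulrC `|p.2|); exact: CauchySchwarz.
Qed.

(** The linearity defect of T is within a multiple of eps of that of an operator
    of finite rank, which is 0. *)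
Lemma finite_rank_limit_linear T : finite_rank_limit T -> linear T.
Proof.
move=> TF c u v; apply/eqP; rewrite -subr_eq0 -normr_eq0 eq_le normr_ge0 andbT.
apply/ler_addgt0Pr => e e0; rewrite add0r.
pose C := `|c *: u + v| + (`|c| * `|u| + `|v|).
have C0 : 0 < C + 1 by rewrite ltr_wpDl// !addr_ge0// mulr_ge0.
have [s sT] := TF _ (divr_gt0 e0 C0).
set eps := e / (C + 1) in sT.
apply: le_trans (ler_distD (rank_op s (c *: u + v)) _ _) _.
apply: (@le_trans _ _ (eps * C)); last first.
  by rewrite /eps mulrAC ler_pdivrMr// ler_pM2l// lerDl.
rewrite mulrDr lerD// rank_op_linear opprD addrACA -scalerBr.
apply: le_trans (ler_normD _ _) _; rewrite normrZ mulrDr lerD//.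
  by rewrite mulrCA ler_wpM2l// distrC.
by rewrite distrC.
Qed.

Lemma finite_rank_limit0 : finite_rank_limit (fun=> 0).
Proof.
move=> e e0; exists [::] => u.
by rewrite /rank_op big_nil subrr normr0 mulr_ge0// ltW.
Qed.

Lemma finite_rank_limitD T1 T2 : finite_rank_limit T1 -> finite_rank_limit T2 ->
  finite_rank_limit (fun u => T1 u + T2 u).
Proof.
move=> F1 F2 e e0; have e2 : 0 < e / 2 by rewrite divr_gt0.
have [[s1 h1] [s2 h2]] := (F1 _ e2, F2 _ e2).
exists (s1 ++ s2) => u; rewrite /rank_op big_cat opprD addrACA.
apply: le_trans (ler_normD _ _) _.
by rewrite [e]splitr mulrDl lerD.
Qed.

Lemma finite_rank_limit_sum (I : Type) (r : seq I) (p : pred I) (T : I -> E -> E) :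
  (forall i, p i -> finite_rank_limit (T i)) ->
  finite_rank_limit (fun u => \sum_(i <- r | p i) T i u).
Proof.
move=> TF; elim: r => [|i r IH].
  rewrite (_ : (fun u => _) = fun=> 0); first exact: finite_rank_limit0.
  by apply/funext => u; rewrite big_nil.
have [pi|pi] := boolP (p i); last first.
  rewrite (_ : (fun u => _) = fun u => \sum_(i <- r | p i) T i u)//.
  by apply/funext => u; rewrite big_cons (negPf pi).
rewrite (_ : (fun u => _) = fun u => T i u + \sum_(i <- r | p i) T i u).
  by apply: finite_rank_limitD => //; exact: TF.
by apply/funext => u; rewrite big_cons pi.
Qed.

Section Compression.
Variables (X : nat -> set E) (P : nat -> E -> E).
Hypotheses (sX : forall n, subspace (X n))
  (X_nested : forall n, X n `<=` X n.+1) (X_dense : dense (\bigcup_n X n))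
  (PX : forall n, orthogonal_projection (X n) (P n)).

(** By density some w in some X_m is e-close to u, w stays in the later X_n, and
    P_n u is the point of X_n closest to u. *)
Lemma projections_cvg u (e : R) : 0 < e ->
  \forall n \near \oo, `|u - P n u| <= e.
Proof.
move=> e0; have [|w [/= uw [m _ Xmw]]] := X_dense _ (ball_open u e).
  by exists u; exact: ballxx.
exists m => // n /= mn.
have Xnw : X n w.
  rewrite -(subnK mn); elim: (n - m)%N => // j IH.
  by rewrite addSn; exact: X_nested.
apply: le_trans (proj_best (sX n) (PX n) u Xnw) _.
by move: uw; rewrite -ball_normE => /ltW.
Qed.

(** As P_n is self-adjoint, one term <u, b> a of the operator and its
    compression differ by <u, b - P_n b> a + <u, P_n b> (a - P_n a), and both
    differences are small. *)
Lemma rank_op_compression_cvg s (e : R) : 0 < e ->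
  \forall n \near \oo, forall u,
    `|rank_op s u - P n (rank_op s (P n u))| <= e * `|u|.
Proof.
elim: s e => [|[a b] s IH] e e0.
  apply: nearW => n u; rewrite /rank_op !big_nil.
  by rewrite (linear_map0 (proj_linear (sX n) (PX n))) subrr normr0 mulr_ge0// ltW.
have e2 : 0 < e / 2 by rewrite divr_gt0.
pose d := e / 2 / (`|a| + `|b| + 1).
have C0 : 0 < `|a| + `|b| + 1 by rewrite ltr_wpDl// addr_ge0.
have d0 : 0 < d by rewrite divr_gt0.
near=> n => u.
have linP := proj_linear (sX n) (PX n).
rewrite /rank_op !big_cons -!/(rank_op s _) linP opprD addrACA /=.
apply: le_trans (ler_normD _ _) _; rewrite [in leRHS](splitr e) mulrDl lerD//; last first.
  by move: u; near: n; exact: IH.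
have -> : dot u b *: a - dot (P n u) b *: P n a =
    dot u (b - P n b) *: a + dot u (P n b) *: (a - P n a).
  by rewrite (proj_adjoint (PX n)) dotBr scalerBl scalerBr addrA subrK.
apply: le_trans (ler_normD _ _) _; rewrite !normrZ.
apply: (@le_trans _ _ (`|u| * d * `|a| + `|u| * `|b| * d)).
  apply: lerD.
    rewrite ler_wpM2r//; apply: le_trans (CauchySchwarz _ _) _.
    by rewrite ler_wpM2l//; near: n; exact: projections_cvg.
  apply: ler_pM => //; last by near: n; exact: projections_cvg.
  apply: le_trans (CauchySchwarz _ _) _; rewrite ler_wpM2l//.
  exact: norm_proj (PX n) _.
have -> : `|u| * d * `|a| + `|u| * `|b| * d = d * (`|a| + `|b|) * `|u| by ring.
by rewrite ler_wpM2r// mulrAC ler_pdivrMr// ler_pM2l// lerDl.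
Unshelve. all: by end_near. Qed.

(** T is replaced by a finite-rank operator twice, inside and outside the
    compression, which is harmless as P_n does not increase the norm. *)
Lemma compression_cvg T (e : R) : finite_rank_limit T -> 0 < e ->
  \forall n \near \oo, forall u, `|T u - P n (T (P n u))| <= e * `|u|.
Proof.
move=> TF e0; have e3 : 0 < e / 3 by rewrite divr_gt0.
have [s sT] := TF _ e3.
near=> n => u.
have linP := proj_linear (sX n) (PX n).
have -> : T u - P n (T (P n u)) = (T u - rank_op s u) +
    (rank_op s u - P n (rank_op s (P n u))) -
    P n (T (P n u) - rank_op s (P n u)).
  by rewrite (linear_mapB _ _ linP) opprB !addrA !subrK.
apply: le_trans (ler_normB _ _) _.
have -> : e * `|u| = e / 3 * `|u| + e / 3 * `|u| + e / 3 * `|u| by field.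
apply: lerD; last first.
  apply: le_trans (norm_proj (PX n) _) _; apply: le_trans (sT _) _.
  by rewrite ler_pM2l//; exact: norm_proj (PX n) _.
apply: le_trans (ler_normD _ _) _; apply: lerD => //.
by move: u; near: n; exact: rank_op_compression_cvg.
Unshelve. all: by end_near. Qed.

Section Perturbation.
Variable T : E -> E.
Hypothesis (linT : linear T).

Let Sbar n u := u - P n (T (P n u)).
Let Sn n u := u - P n (T u).

(** A lower bound for Sbar_n gives the injectivity of both operators.  The
    finite dimension of X_n turns it into surjectivity of S_n, and
    surjectivity passes to Sbar_n because Sbar_n fixes w - P_n w, the part of w
    orthogonal to X_n. *)
Lemma compressed_invertible n M : finite_dim_subspace (X n) ->
  (forall u, `|u| <= M * `|Sbar n u|) ->
  invertible_on setT (Sbar n) /\ invertible_on (X n) (Sn n).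
Proof.
move=> finX SM.
have linP := proj_linear (sX n) (PX n).
have linSn : linear (Sn n).
  by move=> c u v; rewrite /Sn linT linP scalerBr opprD addrACA.
have linSbar : linear (Sbar n).
  by move=> c u v; rewrite /Sbar linP linT linP scalerBr opprD addrACA.
have SE v : X n v -> Sbar n v = Sn n v.
  by move=> Xv; rewrite /Sbar (proj_id (sX n) (PX n) Xv).
have SX v : X n v -> X n (Sn n v).
  by move=> Xv; exact: subspaceB (sX n) Xv (proj_in (PX n) _).
have inj0 u : Sbar n u = 0 -> u = 0.
  move=> Su; apply/normr0_eq0/eqP; rewrite eq_le normr_ge0 andbT.
  by apply: le_trans (SM u) _; rewrite Su normr0 mulr0.
have inj u v : Sbar n u = Sbar n v -> u = v.
  move=> /eqP; rewrite -subr_eq0 -(linear_mapB _ _ linSbar) => /eqP/inj0/eqP.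
  by rewrite subr_eq0 => /eqP.
have surj w : X n w -> exists2 v, X n v & Sn n v = w.
  apply: injective_surjective => // v Xv Sv0; apply: inj0; rewrite SE//.
split; split.
- split=> // [u v _ _|w _]; first exact: inj.
  have [v Xv Sv] := surj (P n w) (proj_in (PX n) w).
  exists (v + (w - P n w)) => //.
  have PP : P n (w - P n w) = 0.
    by rewrite (linear_mapB _ _ linP) (proj_id (sX n) (PX n) (proj_in (PX n) w)) subrr.
  have PvE : P n (v + (w - P n w)) = v.
    by rewrite -[v in LHS]scale1r linP PP addr0 scale1r (proj_id (sX n) (PX n)).
  by rewrite /Sbar PvE addrAC -/(Sn n v) Sv addrC subrK.
- by exists M.
- split=> [//|u v|]; last by move=> w /surj [v Xv <-]; exists v.
  by rewrite !inE => Xu Xv; rewrite -!SE//; exact: inj.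
- by exists M => u Xu; rewrite -SE.
Qed.

End Perturbation.

(** The perturbation argument for any norm limit T of finite-rank operators. *)
Lemma projected_inverse_bounds T : (forall n, finite_dim_subspace (X n)) ->
  finite_rank_limit T ->
  let S u := u - T u in
  let Sbar n u := u - P n (T (P n u)) in
  let Sn n u := u - P n (T u) in
  let norm_inv_S := opnorm setT (opinv setT S) in
  let norm_inv_Sbar n := opnorm setT (opinv setT (Sbar n)) in
  let norm_inv_Sn n := opnorm (X n) (opinv (X n) (Sn n)) in
  let gap n := opnorm setT (fun u => Sbar n u - S u) in
  invertible_on setT S ->
  (\forall n \near \oo,
    [/\ invertible_on setT (Sbar n),
        invertible_on (X n) (Sn n),
        norm_inv_S * gap n < 1,
        norm_inv_Sbar n <= norm_inv_S / (1 - norm_inv_S * gap n) &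
        norm_inv_Sn n <= norm_inv_Sbar n]) /\
  (exists C : R, \forall n \near \oo,
    norm_inv_Sbar n <= C /\ norm_inv_Sn n <= C).
Proof.
move=> finX TF S Sbar Sn sigma sbar sn gap invS.
have linT := finite_rank_limit_linear TF.
have linS : linear S by move=> c u v; rewrite /S linT scalerBr opprD addrACA.
have sigma0 : 0 <= sigma by exact: opnorm_ge0.
(* This threshold for the gap makes sigma * gap at most 1/2, which gives the
   uniform bound 2 * sigma as well as the condition sigma * gap < 1. *)
pose e := (2 * (sigma + 1))^-1.
have e0 : 0 < e by rewrite invr_gt0 mulr_gt0// ltr_wpDl.
have gapE n u : Sbar n u - S u = T u - P n (T (P n u)).
  by rewrite /Sbar /S opprB addrC addrA subrK.
suff bounds : \forall n \near \oo, [/\ invertible_on setT (Sbar n),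
        invertible_on (X n) (Sn n), sigma * gap n <= 2^-1,
        sbar n <= sigma / (1 - sigma * gap n) & sn n <= sbar n].
  split.
    apply: filterS bounds => n [? ? sg ? ?]; split=> //.
    by apply: le_lt_trans sg _; rewrite invf_lt1// ltr1n.
  exists (sigma * 2); apply: filterS bounds => n [_ _ sg sb snb].
  have sb2 : sbar n <= sigma * 2.
    apply: le_trans sb _; rewrite ler_wpM2l//.
    have h : 2^-1 <= 1 - sigma * gap n by lra.
    by rewrite -[leRHS]invrK lef_pV2// posrE; lra.
  by split=> //; apply: le_trans snb sb2.
near=> n.
have small u : `|Sbar n u - S u| <= e * `|u|.
  by rewrite gapE; move: u; near: n; exact: compression_cvg.
have linP := proj_linear (sX n) (PX n).
have gapP u : `|Sbar n u - S u| <= gap n * `|u|.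
  apply: (@le_opnorm _ _ setT (fun u => Sbar n u - S u) e) => // c v _.
  rewrite !gapE.
  by rewrite !(linear_mapZ _ _ linP, linear_mapZ _ _ linT) scalerBr.
have gap_e : gap n <= e by apply: opnorm_le => //; exact: ltW.
have sg : sigma * gap n <= 2^-1.
  apply: le_trans (ler_wpM2l sigma0 gap_e) _.
  by rewrite /e invfM mulrCA ler_piMr// ler_pdivrMr ?ltr_wpDl// mul1r lerDl.
have sg1 : sigma * gap n < 1 by lra.
have lower := perturbed_lower_bound linS invS gapP sg1.
have [invSbar invSn] := compressed_invertible linT (finX n) lower.
have bound0 : 0 <= sigma / (1 - sigma * gap n).
  by rewrite divr_ge0// subr_ge0 ltW.
split=> //; first by apply: opnorm_opinv_le.
apply: opnorm_opinv_le => //; first exact: opnorm_ge0.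
move=> u Xu; have -> : Sn n u = Sbar n u.
  by rewrite /Sbar (proj_id (sX n) (PX n) Xu).
have linSbar : linear (Sbar n).
  by move=> c v w; rewrite /Sbar linP linT linP scalerBr opprD addrACA.
have := le_opnorm_opinv subspaceT invSbar linSbar (v := Sbar n u) I.
by rewrite opinv_unique.
Unshelve. all: by end_near. Qed.
End Compression.
End FiniteRank.
End InnerProduct.

(** * Hausdorff measure *)

Section HausdorffMeasure.
Context {R : realType} {d : nat}.
Implicit Types (A B E : set 'rV[R]_d) (s : nat).
Local Open Scope ereal_scope.

Lemma le_ediam A x y : A x -> A y -> (enorm (x - y))%:E <= ediam A.
Proof. by move=> Ax Ay; apply: ereal_sup_ubound; right; exists x => //; exists y. Qed.

Lemma ediam_le A (e : R) : (0 <= e)%R ->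
  (forall x y, A x -> A y -> (enorm (x - y) <= e)%R) -> ediam A <= e%:E.
Proof.
move=> e0 Ae; apply: ge_ereal_sup => _ [->|[x Ax [y Ay <-]]]; rewrite lee_fin//.
exact: Ae.
Qed.

Lemma hausdorff_pre_anti s e1 e2 A : (e1 <= e2)%R ->
  hausdorff_pre s e2 A <= hausdorff_pre s e1 A.
Proof.
move=> e12; apply: le_ereal_inf => _ [C [Ce AC] <-]; exists C => //.
by split=> // k; rewrite (le_trans (Ce k))// lee_fin.
Qed.

Lemma hausdorff_pre_le s e A : (0 < e)%R -> hausdorff_pre s e A <= hausdorff s A.
Proof. by move=> e0; apply: ereal_sup_ubound; exists e. Qed.

(** A covering set of diameter at most e meets at most one of A and B, so a
    covering of the union splits into a covering of A and one of B. *)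
Lemma hausdorff_pre_add s (e : R) A B : (0 < e)%R ->
  (forall x y, A x -> B y -> (e < enorm (x - y))%R) ->
  hausdorff_pre s e A + hausdorff_pre s e B <= hausdorff_pre s e (A `|` B).
Proof.
move=> e0 AB; apply: le_ereal_inf_tmp => _ [C [Ce ABC] <-].
pose meet D k := if pselect (C k `&` D !=set0) then C k else set0.
have gauge0 : hausdorff_gauge s (set0 : set 'rV[R]_d) = 0.
  by rewrite /hausdorff_gauge eqxx.
have g0 (D : set 'rV[R]_d) : 0 <= hausdorff_gauge s D by exact: hausdorff_gauge_ge0.
have pre_meet D : D `<=` A `|` B ->
    hausdorff_pre s e D <= \sum_(k <oo) hausdorff_gauge s (meet D k).
  move=> DAB; apply: ereal_inf_lbound; exists (meet D) => //; split=> [k|x Dx].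
    rewrite /meet; case: pselect => [?|?] /=; first exact: Ce.
    by apply: ediam_le => //; exact: ltW.
  have [k _ Ckx] := ABC _ (DAB _ Dx); exists k => //.
  by rewrite /meet; case: pselect => // -[]; exists x.
have := leeD (pre_meet A (@subsetUl _ _ _)) (pre_meet B (@subsetUr _ _ _)).
move=> /le_trans; apply.
rewrite -nneseriesD//; apply: lee_nneseries => [k _ _|k _]; first exact: adde_ge0.
rewrite /meet; case: pselect => [[x [Cx Ax]]|?] /=; last first.
  by rewrite gauge0 add0e; case: pselect => [?|?] //=; rewrite gauge0.
case: pselect => [[y [Cy By]]|?] /=; last by rewrite gauge0 adde0.
have := le_trans (le_ediam Cx Cy) (Ce k).
by rewrite lee_fin leNgt AB.
Qed.

(** The Hausdorff measure is a metric outer measure. *)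
Lemma hausdorff_add s (e : R) A B : (0 < e)%R ->
  (forall x y, A x -> B y -> (e < enorm (x - y))%R) ->
  hausdorff s A + hausdorff s B <= hausdorff s (A `|` B).
Proof.
move=> e0 AB; have [->|] := eqVneq (hausdorff s (A `|` B)) +oo; first exact: leey.
rewrite -ltey => fin.
have le1 e1 e2 : (0 < e1)%R -> (0 < e2)%R ->
    hausdorff_pre s e1 A + hausdorff_pre s e2 B <= hausdorff s (A `|` B).
  move=> e10 e20; pose m := Num.min e (Num.min e1 e2).
  have m0 : (0 < m)%R by rewrite !lt_min e0 e10.
  have [me me12] : (m <= e)%R /\ ((m <= e1)%R /\ (m <= e2)%R).
    by rewrite /m; split; last split; rewrite !ge_min lexx ?orbT.
  apply: le_trans (hausdorff_pre_le s (A `|` B) m0).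
  apply: le_trans (hausdorff_pre_add s m0 _); last first.
    by move=> x y Ax By; exact: le_lt_trans (AB _ _ Ax By).
  by apply: leeD; apply: hausdorff_pre_anti; case: me12.
have preB e2 : (0 < e2)%R -> hausdorff_pre s e2 B \is a fin_num.
  move=> e20; rewrite ge0_fin_numE ?hausdorff_pre_ge0//.
  apply: le_lt_trans fin; apply: le_trans (le1 _ _ e20 e20).
  by rewrite leeDr// hausdorff_pre_ge0.
have le2 e2 : (0 < e2)%R ->
    hausdorff s A + hausdorff_pre s e2 B <= hausdorff s (A `|` B).
  move=> e20; rewrite -leeBrDr ?preB//; apply: ge_ereal_sup => _ [e1 e10 <-].
  by rewrite leeBrDr ?preB//; exact: le1.
have H0 : 0 <= hausdorff s A.
  by apply: le_trans (hausdorff_pre_le s A ltr01); exact: hausdorff_pre_ge0.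
have fA : hausdorff s A \is a fin_num.
  rewrite ge0_fin_numE//; apply: le_lt_trans fin; apply: le_trans (le2 _ ltr01).
  by rewrite leeDl// hausdorff_pre_ge0.
rewrite -leeBrDl//; apply: ge_ereal_sup => _ [e2 e20 <-].
by rewrite leeBrDl//; exact: le2.
Qed.

Lemma surface_add A (e : R) B E : (0 < e)%R ->
  (forall x y, B x -> E y -> (e < enorm (x - y))%R) ->
  surface A B + surface A E <= surface A (B `|` E).
Proof.
move=> e0 BE; rewrite /surface setIUl; apply: (hausdorff_add _ e0).
by move=> x y [Bx _] [Ey _]; exact: BE.
Qed.

(** Caratheodory's criterion for metric outer measures.  As f is
    1-Lipschitz, the parts of a test set E where f < t_k and where t <= f are at
    positive distance, so their measures add up to at most that of E, and it
    remains to let t_k increase to t.  The part of E between these levels is cut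
    into layers, whose total measure is finite, so that the tails of the series
    tend to 0. *)
Lemma surface_measurable_sublevel A (f : 'rV[R]_d -> R) (t : R) :
  (forall x y, (`|f x - f y| <= enorm (x - y))%R) ->
  measurable ([set x | (f x < t)%R] : set (surfaceType A)).
Proof.
move=> f_lip; set C := [set x | _].
pose mu := surface_outer A.
apply: (@le_caratheodory_measurable _ _ mu) => E.
have [->|] := eqVneq (mu E) +oo; first exact: leey.
rewrite -ltey => finE.
pose t_ (k : nat) : R := (t - k.+1%:R^-1)%R.
have t_lt k : (t_ k < t_ k.+1)%R.
  by rewrite ltrD2l ltrN2 ltf_pV2 ?posrE// ltr_nat.
have t_le := (homo_leq (@lexx _ _) (@le_trans _ _) (fun k => ltW (t_lt k))).
have tt k : (t_ k < t)%R by rewrite gtrBl invr_gt0.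
pose inner k := E `&` [set x | (f x < t_ k)%R].
pose layer k := E `&` [set x | (t_ k <= f x < t_ k.+1)%R].
have le_mu (B D : set 'rV[R]_d) : B `<=` D -> mu B <= mu D.
  exact: le_outer_measure.
have inner_le k : mu (inner k) <= mu E by apply: le_mu; exact: subIsetl.
have separated (B D : set 'rV[R]_d) (r q : R) : (r < q)%R ->
    (forall x, B x -> (f x < r)%R) -> (forall y, D y -> (q <= f y)%R) ->
    mu B + mu D <= mu (B `|` D).
  move=> rq Br Dq; apply: (@surface_add A (q - r)%R); first by rewrite subr_gt0.
  move=> x y /Br fx /Dq fy; apply: lt_le_trans (f_lip x y).
  by rewrite distrC; apply: lt_le_trans (ler_norm _); lra.
(* Layer n is at positive distance from the inner part of index n - 1, so each
   new layer can be merged with the older of the two inner parts. *)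
have layers_le n : \sum_(0 <= k < n.+1) mu (layer k) <= mu (inner n) + mu (inner n.+1).
  elim: n => [|n IH].
    rewrite big_nat1 (@le_trans _ _ (mu (inner 1%N)))//.
      by apply: le_mu => x [Ex /andP[_ ?]]; split.
    by rewrite leeDr// outer_measure_ge0.
  rewrite big_nat_recr//=; apply: le_trans (leeD IH (lexx _)) _.
  rewrite addeAC addeC leeD2l//.
  apply: le_trans (@separated _ _ _ _ (t_lt n) _ _) _ => [x [] //|x [] _ /andP[]//|].
  apply: le_mu => x [[Ex /= fx]|[Ex /andP[_ ?]]]; split=> //=.
  by apply: lt_le_trans fx _; by apply: t_le; rewrite -addn2 leq_addr.
have sum_fin : \sum_(0 <= k <oo) mu (layer k) < +oo.
  apply: (@le_lt_trans _ _ (mu E + mu E)); last by rewrite lte_add_pinfty.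
  apply: lime_le; first by apply: is_cvg_nneseries => k _ _; exact: outer_measure_ge0.
  exists 1%N => // -[//|n] _.
  by apply: le_trans (layers_le n) _; rewrite leeD.
have tail0 := nneseries_tail_cvg sum_fin (fun k _ => outer_measure_ge0 mu (layer k)).
apply/lee_addgt0Pr => e e0.
have [n tail_n] : exists n, \sum_(n <= k <oo) mu (layer k) <= e%:E.
  move/fine_cvgP : tail0 => [[m _ tail_fin] /cvgrPdist_lt /(_ _ e0)[n _ /= tail_lt]].
  exists (maxn m n); rewrite -[leLHS]fineK; last first.
    by apply: tail_fin => /=; exact: leq_maxl.
  rewrite lee_fin; have := tail_lt _ (leq_maxr m n).
  by rewrite sub0r normrN => /ltW; apply: le_trans (ler_norm _).
have EC : mu (E `&` C) <= mu (inner n) + e%:E.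
  apply: le_trans (leeD (lexx _) tail_n).
  apply: le_trans (leeD (lexx _) (outer_measure_sigma_subadditive_tail _ _ _)).
  apply: le_trans (outer_measureU2 _ _ _); apply: le_mu => x [Ex fx].
  have [fn|fn] := ltP (f x) (t_ n); [by left|right].
  have ex_k : exists k, (f x < t_ k)%R.
    have h : (0 < t - f x)%R by rewrite subr_gt0.
    exists (Num.truncn (t - f x)^-1); rewrite /t_ ltrBrDl -ltrBrDr.
    rewrite invf_plt ?posrE//; exact: truncnS_gt.
  case: (ex_minnP ex_k) => -[|k] fk kmin.
    by move: fn; rewrite leNgt (lt_le_trans fk)// t_le.
  have fxk : (t_ k <= f x)%R by rewrite leNgt; apply/negP => /kmin; rewrite ltnn.
  exists k; last by split=> //=; rewrite fxk.
  by move=> /= kn; move: fn; rewrite leNgt (lt_le_trans fk)// t_le.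
apply: le_trans (leeD EC (lexx _)) _.
rewrite addeAC leeD2r//; apply: le_trans (separated _ _ _ _ (tt n) _ _) _.
- by move=> x [].
- by move=> x [_ /negP]; rewrite -leNgt.
- by apply: le_mu => x [[]|[]].
Qed.

Lemma coord_le_enorm (x : 'rV[R]_d) i : (`|x 0 i| <= enorm x)%R.
Proof.
rewrite -sqrtr_sqr ler_wsqrtr// /edot (bigD1 i)//= -expr2 lerDl.
by apply: sumr_ge0 => j _; rewrite -expr2 sqr_ge0.
Qed.

Lemma norm_le_enorm (x : 'rV[R]_d) : (`|x| <= enorm x)%R.
Proof.
rewrite [leLHS]/Num.Def.normr/= mx_normrE bigmax_le ?sqrtr_ge0// => -[i j] _ /=.
by rewrite ord1 coord_le_enorm.
Qed.

Lemma surface_measurable_ball A (x : 'rV[R]_d) (r : R) :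
  measurable (ball x r : set (surfaceType A)).
Proof.
rewrite -ball_normE; apply: (@surface_measurable_sublevel A (fun y => `|x - y|%R)).
move=> y z; apply: le_trans (norm_le_enorm _).
apply: le_trans (ler_dist_dist _ _) _.
by rewrite opprB addrC addrA subrK distrC.
Qed.

Lemma surface_null_measurable A B : surface A B = 0 ->
  measurable (B : set (surfaceType A)).
Proof.
move=> B0; apply: (@le_caratheodory_measurable _ _ (surface_outer A)) => E.
rewrite [X in X + _](_ : _ = 0).
  by rewrite add0e; apply: le_outer_measure; exact: subIsetl.
apply/eqP; rewrite eq_le outer_measure_ge0 andbT -[leRHS]B0.
by apply: (le_outer_measure (surface_outer A)); exact: subIsetr.
Qed.

Lemma surface_setC A : surface A (~` A) = 0.
Proof. by have := surface0 A; rewrite /surface setICl set0I. Qed.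

Lemma enorm_le_sum (x : 'rV[R]_d) : (enorm x <= \sum_i `|x 0 i|)%R.
Proof.
have s0 : (0 <= \sum_i `|x 0 i|)%R by exact: sumr_ge0.
rewrite -[leRHS](ger0_norm s0) -sqrtr_sqr ler_wsqrtr// /edot expr2 mulr_suml.
apply: ler_sum => i _; rewrite -expr2 -real_normK ?num_real// expr2 ler_wpM2l//.
by rewrite (bigD1 i)//= lerDl sumr_ge0.
Qed.

Lemma le_expe (x y : \bar R) k : 0 <= x -> x <= y -> x ^+ k <= y ^+ k.
Proof.
move=> x0 xy; elim: k => [|k IH]; first by rewrite !expe0.
by rewrite !expeS lee_pmul// expe_ge0.
Qed.

End HausdorffMeasure.

(** On the hyperplane one coordinate is a linear function of the d others.
    Cutting the d others into n intervals each gives n ^ d cells of diameter at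
    most L / n, and the corresponding sum n ^ d * (L / n) ^ d does not depend on
    the mesh. *)
Lemma hyperplane_piece_finite (R : realType) (d : nat) (nu : 'rV[R]_d.+1)
    (c M : R) (A : set 'rV[R]_d.+1) : enorm nu = 1 ->
  (forall x, A x -> edot nu x = c) -> (forall x i, A x -> `|x 0 i| < M) ->
  (hausdorff d A < +oo)%E.
Proof.
move=> nu1 Ac AM.
have [i0 nui0] : exists i0, nu 0 i0 != 0.
  apply/existsP; rewrite -[X in is_true X]negbK negb_exists; apply/negP => /forallP nu0.
  have : enorm nu = 0.
    rewrite /enorm /edot big1 ?sqrtr0// => i _.
    by have := nu0 i; rewrite negbK => /eqP ->; rewrite mul0r.
  by rewrite nu1; apply/eqP; exact: oner_neq0.
pose B : R := \sum_(j < d) `|nu 0 (lift i0 j)| / `|nu 0 i0|.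
have B0 : 0 <= B by apply: sumr_ge0 => j _; rewrite divr_ge0.
have M0 x : A x -> 0 < M by move=> /(AM _ ord0); apply: le_lt_trans.
(* B bounds the variation of coordinate i0 by that of the other coordinates, and
   the enorm is at most the sum of the absolute values of all the coordinates. *)
pose L : R := (B + d%:R) * (2 * `|M|).
have L0 : 0 <= L by rewrite mulr_ge0// addr_ge0.
have diam_cell (h : R) (D : set 'rV[R]_d.+1) : 0 <= h -> D `<=` A ->
    (forall x y j, D x -> D y -> `|x 0 (lift i0 j) - y 0 (lift i0 j)| <= h) ->
    (ediam D <= ((B + d%:R) * h)%:E)%E.
  move=> h0 DA Dh; apply: ediam_le => [|x y Dx Dy]; first by rewrite mulr_ge0// addr_ge0.
  apply: le_trans (enorm_le_sum _) _.
  have zE i : (x - y) 0 i = x 0 i - y 0 i by rewrite !mxE.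
  rewrite (bigD1_ord i0)//= mulrDl lerD//; last first.
    rewrite mulrC -[in leRHS](card_ord d) mulr_natr -sumr_const.
    by apply: ler_sum => j _; rewrite zE; exact: Dh.
  have sum0 : \sum_i nu 0 i * (x - y) 0 i = 0.
    transitivity (edot nu x - edot nu y); last by rewrite !Ac ?subrr//; exact: DA.
    rewrite /edot -[RHS]sumrB; apply: eq_bigr => i _; rewrite zE; exact: mulrBr.
  have nu_gt0 : 0 < `|nu 0 i0| by rewrite normr_gt0.
  have -> : (x - y) 0 i0 =
      - (\sum_(j < d) nu 0 (lift i0 j) * (x - y) 0 (lift i0 j)) / nu 0 i0.
    apply: (mulfI nui0); rewrite mulrCA mulfV// mulr1.
    by apply/eqP; move: sum0; rewrite (bigD1_ord i0)//= => /eqP; rewrite addr_eq0.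
  rewrite normrM normrN normfV ler_pdivrMr//.
  apply: le_trans (ler_norm_sum _ _ _) _.
  rewrite /B -mulr_suml mulrAC divfK ?gt_eqF// mulr_suml; apply: ler_sum => j _.
  by rewrite normrM ler_wpM2l// zE; exact: Dh.
have main (e : R) : 0 < e -> (hausdorff_pre d e A <= (half_ball_volume R d * L ^+ d)%:E)%E.
  move=> e0; pose n := (Num.truncn (L / e)).+1.
  have Ln : L / n%:R <= e.
    by rewrite ler_pdivrMr// mulrC -ler_pdivrMr// ltW// /n truncnS_gt.
  pose h : R := 2 * `|M| / n%:R.
  pose cell (p : {ffun 'I_d -> 'I_n}) := A `&` [set x : 'rV[R]_d.+1 | forall j : 'I_d,
    (p j)%:R * h <= x 0 (lift i0 j) + M <= (p j).+1%:R * h].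
  pose N := #|{ffun 'I_d -> 'I_n}|.
  pose C k := if insub k is Some i then cell (enum_val (i : 'I_N)) else set0.
  have h0 : 0 <= h by rewrite divr_ge0// mulr_ge0.
  have cellE p : (ediam (cell p) <= (L / n%:R)%:E)%E.
    rewrite /L -mulrA -/h; apply: diam_cell => //; first exact: subIsetl.
    move=> x y j [_ /(_ j)/andP[x1 x2]] [_ /(_ j)/andP[y1 y2]].
    move: x2 y2; rewrite -natr1 mulrDl mul1r => x2 y2.
    by rewrite ler_norml; apply/andP; split; lra.
  have CE k : (ediam (C k) <= (L / n%:R)%:E)%E.
    rewrite /C; case: insub => [i|]; first exact: cellE.
    by apply: ediam_le => //; rewrite divr_ge0.
  apply: (@le_trans _ _ (\sum_(k <oo) hausdorff_gauge d (C k))%E).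
    apply: ereal_inf_lbound; exists C => //; split=> [k|x Ax].
      by apply: le_trans (CE k) _; rewrite lee_fin.
    have Mgt0 := M0 _ Ax.
    have MM : `|M| = M by rewrite ger0_norm// ltW.
    have hgt0 : 0 < h by rewrite /h MM divr_gt0// mulr_gt0.
    have pos (j : 'I_d) : 0 <= (x 0 (lift i0 j) + M) / h.
      rewrite divr_ge0//; have := AM _ (lift i0 j) Ax; rewrite ltr_norml => /andP[]; lra.
    have lt_n (j : 'I_d) : (Num.truncn ((x 0%R (lift i0 j) + M) / h)%R < n)%N.
      rewrite truncn_lt_nat// ltr_pdivrMr// /h MM mulrC divfK ?pnatr_eq0//.
      by have := AM _ (lift i0 j) Ax; rewrite ltr_norml => /andP[]; lra.
    pose p : {ffun 'I_d -> 'I_n} := [ffun j => Ordinal (lt_n j)].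
    exists (enum_rank p : nat) => //.
    rewrite /C insubT; first exact: ltn_ord.
    move=> lt_r; rewrite (_ : Sub _ _ = enum_rank p); last exact: val_inj.
    rewrite enum_rankK; split=> // j; rewrite ffunE /=.
    by have /andP[] := truncn_itv (pos j);
      rewrite ler_pdivlMr// ltr_pdivrMr// => -> /ltW.
  have gauge_le k : (hausdorff_gauge d (C k) <=
      (half_ball_volume R d * (L / n%:R) ^+ d)%:E)%E.
    rewrite /hausdorff_gauge; case: ifP => _.
      by rewrite lee_fin mulr_ge0 ?half_ball_volume_ge0// exprn_ge0// divr_ge0.
    rewrite EFinM lee_wpmul2l ?lee_fin ?half_ball_volume_ge0// EFin_expe.
    by apply: le_expe => //; exact: ediam_ge0.
  rewrite (nneseries_split 0 N); last by move=> k _; exact: hausdorff_gauge_ge0.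
  rewrite add0n [X in (_ + X)%E]eseries0 ?adde0; last first.
    move=> k Nk _; rewrite /C insubF; last by apply/negbTE; rewrite -leqNgt.
    by rewrite /hausdorff_gauge eqxx.
  apply: le_trans (lee_sum _ (fun k _ => gauge_le k)) _.
  rewrite sumEFin lee_fin sumr_const_nat subn0 /N card_ffun !card_ord.
  by rewrite -[_ *+ (n ^ d)]mulr_natr -mulrA natrX -exprMn divfK ?pnatr_eq0.
apply: (@le_lt_trans _ _ (half_ball_volume R d * L ^+ d)%:E); last exact: ltry.
by apply: ge_ereal_sup => _ [e e0 <-]; exact: main.
Qed.

(** * Square-integrable functions on a space of finite measure *)

Section FiniteMeasure.
Context {disp : measure_display} {T : measurableType disp} {R : realType}.
Variable mu : {measure set T -> \bar R}.
Hypothesis mu_fin : (mu setT < +oo)%E.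
Implicit Types (f : T -> R) (A : set T) (C : R).

Lemma L2_CauchySchwarz (u v : L2 mu) : L2_dot u v ^+ 2 <= L2_dot u u * L2_dot v v.
Proof.
have := @L2sum_CauchySchwarz R 'I_1 _ _ (fun=> mu) (fun=> u) (fun=> v).
by rewrite /L2sum_dot !big_ord1.
Qed.

Lemma bounded_integral_sqr f C : measurable_fun setT f ->
  {ae mu, forall x, `|f x| <= C} ->
  (\int[mu]_x (f x * f x)%:E <= (C ^+ 2)%:E * mu setT)%E.
Proof.
move=> mf fC; rewrite -integral_cst//; apply: ae_ge0_le_integral => //.
- by move=> x _; rewrite lee_fin -expr2 sqr_ge0.
- by apply/measurable_EFinP; exact: measurable_funM.
- by move=> x _; rewrite lee_fin sqr_ge0.
apply: filterS fC => x fx _; rewrite lee_fin -expr2 -real_normK ?num_real//.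
by rewrite lerXn2r ?nnegrE// (le_trans _ fx).
Qed.

Lemma bounded_in_Lfun2 f C : measurable_fun setT f ->
  {ae mu, forall x, `|f x| <= C} -> f \in Lfun mu 2%:E.
Proof.
move=> mf fC; apply/andP; split; rewrite inE//= /finite_norm unlock poweR_lty//.
rewrite (eq_integral (fun x => (f x * f x)%:E)); last first.
  move=> x _; rewrite /= powR_mulrn//.
  by rewrite real_normK ?num_real// expr2.
apply: le_lt_trans (bounded_integral_sqr mf fC) _.
by rewrite lte_mul_pinfty// lee_fin sqr_ge0.
Qed.

(** Reduces statements on the classes [toL2 mu f] to pointwise ones. *)
Lemma toL2E f : f \in Lfun mu 2%:E ->
  exists2 F : L2fun mu, toL2 mu f = (\pi_(L2 mu) F)%qT & F =1 f.
Proof.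
by move=> fL; rewrite /toL2; case: pselect => // fL'; exists (Lfun_Sub (lee1n 2) fL').
Qed.

Lemma dot_toL2 f (u : L2 mu) : f \in Lfun mu 2%:E ->
  L2_dot (toL2 mu f) u = (\int[mu]_x (f x * (repr u : L2fun mu) x))%R.
Proof.
move=> /toL2E [F -> Ff]; rewrite -{1}[u]reprK L2_dot_pi.
by apply: eq_Rintegral => x _; rewrite Ff.
Qed.

Lemma toL2D f g : f \in Lfun mu 2%:E -> g \in Lfun mu 2%:E ->
  toL2 mu (fun x => f x + g x) = toL2 mu f + toL2 mu g.
Proof.
move=> fL gL; have fgL : (fun x => f x + g x) \in Lfun mu 2%:E.
  exact: (Lfun_addr_closed mu (lee1n 2)).2.
have [F -> Ff] := toL2E fL; have [G -> Gg] := toL2E gL.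
have [K -> Kk] := toL2E fgL; rewrite -L2_piD; congr (\pi_(L2 mu) _)%qT.
by apply/LfuneqP => x; rewrite Kk -Ff -Gg.
Qed.

Lemma toL2Z c f : f \in Lfun mu 2%:E ->
  toL2 mu (fun x => c * f x) = c *: toL2 mu f.
Proof.
move=> fL; have cfL : (fun x => c * f x) \in Lfun mu 2%:E.
  rewrite (_ : (fun x => c * f x) = c \o* f); first by apply: Lfun_scale => //; rewrite ler1n.
  by apply/funext => x; rewrite /= mulrC.
have [F -> Ff] := toL2E fL; have [K -> Kk] := toL2E cfL.
transitivity (\pi_(L2 mu) (c *: F))%qT; last by rewrite -L2_scale_pi.
by congr (\pi_(L2 mu) _)%qT; apply/LfuneqP => x; rewrite Kk -Ff.
Qed.

(** The approximation is only required on a set A of full measure; off a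
    measurable null set f is a pointwise limit of measurable functions, and
    completeness does the rest. *)
Lemma measurable_uniform_limit f A : measure_is_complete mu ->
  {ae mu, forall x, A x} ->
  (forall e : R, 0 < e ->
    exists2 h : T -> R, measurable_fun setT h & forall x, A x -> `|f x - h x| <= e) ->
  measurable_fun setT f.
Proof.
move=> complete [N [mN N0 AN]] fh.
have [h hP] : {h : nat -> T -> R & forall n, measurable_fun setT (h n) /\
    forall x, A x -> `|f x - h n x| <= n.+1%:R^-1}.
  apply: (@choice _ _ (fun n (h : T -> R) => measurable_fun setT h /\
    forall x, A x -> `|f x - h x| <= n.+1%:R^-1)) => n.
  by have [|h mh fh'] := fh n.+1%:R^-1; [rewrite invr_gt0|exists h].
pose cut k x : R := \1_(~` N) x * k x.
have mcut : measurable_fun setT (fun x => (cut f x)%:E).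
  apply: (@emeasurable_fun_cvg _ _ _ _ (fun n x => (cut (h n) x)%:E)) => [n|x _].
    apply/measurable_EFinP/measurable_funM; last by case: (hP n).
    by apply/measurable_indic/measurableC.
  apply: cvg_EFin; first exact: nearW.
  apply/cvgrPdist_le => e e0; near=> n.
  rewrite /= -mulrBr normrM /indic; case: (boolP (x \in ~` N)) => xN; last first.
    by rewrite normr0 mul0r ltW.
  rewrite normr1 mul1r.
  have Ax : A x by move: xN; rewrite inE => xN; apply: contrapT => /AN.
  apply: le_trans ((hP n).2 _ Ax) _.
  by apply: ltW; near: n; exact: (near_infty_natSinv_lt (PosNum e0)).
apply/measurable_EFinP; apply: (ae_measurable_fun complete _ mcut).
exists N; split=> // x /= /not_implyP[_ fx]; apply: contrapT => Nx; apply: fx.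
by rewrite /cut indicE mem_set// mul1r.
Unshelve. all: by end_near. Qed.

End FiniteMeasure.

(** * Integral operators and step kernels *)

Section KernelOperators.
Context {R : realType} {d1 d2 : measure_display}.
Context {T1 : measurableType d1} {T2 : measurableType d2}.
Variables (mu1 : {measure set T1 -> \bar R}) (mu2 : {measure set T2 -> \bar R}).
Hypotheses (mu1_fin : (mu1 setT < +oo)%E) (mu2_fin : (mu2 setT < +oo)%E).
Implicit Types (g s : T1 -> T2 -> R) (phi : L2 mu2).

Definition kernel_fun g phi : T1 -> R :=
  fun x => (\int[mu2]_y (g x y * (repr phi : L2fun mu2) y))%R.

Definition kernel_op g phi : L2 mu1 := toL2 mu1 (kernel_fun g phi).

(** Finite combinations of indicators of measurable rectangles.  The inductive
    form makes closure properties and the finite-rank property plain inductions. *)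
Inductive step_kernel : (T1 -> T2 -> R) -> Prop :=
| step_kernel0 : step_kernel (fun _ _ => 0)
| step_kernelD (c : R) U V s : measurable U -> measurable V -> step_kernel s ->
    step_kernel (fun x y => c * \1_U x * \1_V y + s x y).

Lemma step_kernel_indic U V s : measurable U -> measurable V -> step_kernel s ->
  step_kernel (fun x y => \1_U x * \1_V y * s x y).
Proof.
move=> mU mV; elim=> [|c U' V' s' mU' mV' _ IH].
  rewrite (_ : (fun _ => _) = fun _ _ => 0); first exact: step_kernel0.
  by apply/funext => x; apply/funext => y; rewrite mulr0.
rewrite (_ : (fun _ => _) = fun x y =>
    c * \1_(U `&` U') x * \1_(V `&` V') y + \1_U x * \1_V y * s' x y).
  by apply: step_kernelD => //; exact: measurableI.
by apply/funext => x; apply/funext => y; rewrite !indicI /=; ring.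
Qed.

Lemma step_kernel_linear a s1 s2 : step_kernel s1 -> step_kernel s2 ->
  step_kernel (fun x y => s1 x y + a * s2 x y).
Proof.
move=> h1; elim=> [|c U V s mU mV _ IH].
  rewrite (_ : (fun _ => _) = s1)//.
  by apply/funext => x; apply/funext => y; rewrite mulr0 addr0.
rewrite (_ : (fun _ => _) = fun x y =>
    a * c * \1_U x * \1_V y + (s1 x y + a * s x y)); first exact: step_kernelD.
by apply/funext => x; apply/funext => y; ring.
Qed.

Lemma step_kernel_cst c : step_kernel (fun _ _ => c).
Proof.
rewrite (_ : (fun _ => _) = fun x y => c * \1_setT x * \1_setT y + 0).
  exact: step_kernelD step_kernel0.
by apply/funext => x; apply/funext => y; rewrite !indicT !mulr1 addr0.
Qed.

(** Rectangles are added one at a time: on the new rectangle the current step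
    kernel s is overwritten by the constant c i, by adding the product of
    (c i - s) with the indicator of the rectangle. *)
Lemma step_kernel_cover (I : eqType) (r : seq I) (U : I -> set T1) (V : I -> set T2)
    (c : I -> R) g (Q : T1 -> T2 -> Prop) (e : R) :
  (forall i, measurable (U i)) -> (forall i, measurable (V i)) ->
  (forall i x y, Q x y -> U i x -> V i y -> `|g x y - c i| <= e) ->
  exists2 s, step_kernel s & forall x y, Q x y ->
    (exists2 i, i \in r & U i x /\ V i y) -> `|g x y - s x y| <= e.
Proof.
move=> mU mV gc; elim: r => [|i r [s hs sP]].
  by exists (fun _ _ => 0); [exact: step_kernel0|move=> x y _ []].
pose mask x y : R := \1_(U i) x * \1_(V i) y * (c i + -1 * s x y).
have hmask : step_kernel mask.
  apply: step_kernel_indic => //; apply: step_kernel_linear => //.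
  exact: step_kernel_cst.
exists (fun x y => s x y + 1 * mask x y); first exact: step_kernel_linear.
move=> x y Qxy [j jr [Ujx Vjy]]; rewrite mul1r.
have [[Ux Vy]|NUV] := pselect (U i x /\ V i y).
  rewrite /mask !indicE !mem_set// !mul1r mulN1r addrCA subrr addr0.
  exact: gc Qxy Ux Vy.
have -> : mask x y = 0.
  rewrite /mask !indicE; case: (boolP (x \in U i)) => [/set_mem Ux|]; last by rewrite !mul0r.
  case: (boolP (y \in V i)) => [/set_mem Vy|]; last by rewrite mulr0 mul0r.
  by case: NUV.
rewrite addr0; apply: sP => //; move: jr; rewrite inE => /predU1P[ij|jr].
  by case: NUV; rewrite -ij.
by exists j.
Qed.

Lemma indic_Lfun2 d (T : measurableType d) (mu : {measure set T -> \bar R}) U :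
  (mu setT < +oo)%E -> measurable U -> (\1_U : T -> R) \in Lfun mu 2%:E.
Proof.
move=> mu_fin mU; apply: (@bounded_in_Lfun2 _ _ _ _ mu_fin _ 1).
  exact: measurable_indic.
by apply: nearW => x; rewrite indicE; case: (_ \in _); rewrite ?normr1 ?normr0.
Qed.

Lemma step_kernel_section s x : step_kernel s -> s x \in Lfun mu2 2%:E.
Proof.
elim=> [|c U V s' mU mV _ IH].
  apply: (@bounded_in_Lfun2 _ _ _ _ mu2_fin _ 0); first exact: measurable_cst.
  by apply: nearW => y; rewrite normr0.
apply: (Lfun_addr_closed mu2 (lee1n 2)).2 => //.
rewrite (_ : (fun y => _) = (c * \1_U x) \o* \1_V).
  by apply: Lfun_scale; [rewrite ler1n|exact: indic_Lfun2].
by apply/funext => y; rewrite /= mulrC.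
Qed.

Lemma mulL2_integrable (f : T2 -> R) phi : f \in Lfun mu2 2%:E ->
  mu2.-integrable setT (EFin \o (fun y => f y * (repr phi : L2fun mu2) y)).
Proof. by move=> fL; apply/Lfun1_integrable/Lfun2_mul_Lfun1 => //; exact: LfunP. Qed.

(** A term c 1_U(x) 1_V(y) contributes the operator phi |-> <phi, 1_V> (c 1_U). *)
Lemma step_kernel_finite_rank s : step_kernel s ->
  exists r : seq (L2 mu1 * L2 mu2), forall phi,
    kernel_fun s phi \in Lfun mu1 2%:E /\
    kernel_op s phi = \sum_(p <- r) L2_dot phi p.2 *: p.1.
Proof.
elim=> [|c U V s' mU mV hs' [r rP]].
  exists [::] => phi; rewrite /kernel_op.
  have -> : kernel_fun (fun _ _ => 0) phi = fun x => 0 * \1_setT x.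
    apply/funext => x; rewrite mul0r /kernel_fun.
    by under eq_Rintegral do rewrite mul0r; rewrite Rintegral_cst// mul0r.
  have L1 := indic_Lfun2 mu1_fin (@measurableT _ T1).
  split; last by rewrite toL2Z// scale0r big_nil.
  rewrite (_ : (fun x => _) = 0 \o* \1_setT); last by apply/funext => x; rewrite /= mulrC.
  by apply: Lfun_scale => //; rewrite ler1n.
exists ((c *: toL2 mu1 \1_U, toL2 mu2 \1_V) :: r) => phi.
have [sL sE] := rP phi.
have LU := indic_Lfun2 mu1_fin mU; have LV := indic_Lfun2 mu2_fin mV.
have kE : kernel_fun (fun x y => c * \1_U x * \1_V y + s' x y) phi =
    fun x => (L2_dot phi (toL2 mu2 \1_V) * c) * \1_U x + kernel_fun s' phi x.
  apply/funext => x; rewrite /kernel_fun L2_dotC dot_toL2//.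
  under eq_Rintegral do rewrite mulrDl -mulrA.
  rewrite RintegralD//; last 2 first.
  - have := mulL2_integrable phi (step_kernel_section x
      (step_kernelD c mU mV step_kernel0)).
    by congr integrable; apply/funext => y /=; rewrite addr0 mulrA.
  - exact: mulL2_integrable (step_kernel_section x hs').
  by rewrite RintegralZl//; [congr (_ + _); ring|exact: mulL2_integrable].
have LcU : (fun x => (L2_dot phi (toL2 mu2 \1_V) * c) * \1_U x) \in Lfun mu1 2%:E.
  rewrite (_ : (fun x => _) = (L2_dot phi (toL2 mu2 \1_V) * c) \o* \1_U).
    by apply: Lfun_scale => //; rewrite ler1n.
  by apply/funext => x; rewrite /= mulrC.
rewrite /kernel_op kE; split; first exact: (Lfun_addr_closed mu1 (lee1n 2)).2.
by rewrite toL2D// toL2Z// big_cons -sE scalerA.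
Qed.

Section UniformLimit.
Variables (g : T1 -> T2 -> R) (A : set T1) (B : set T2).
Hypotheses (complete1 : measure_is_complete mu1) (complete2 : measure_is_complete mu2)
  (A_full : {ae mu1, forall x, A x}) (B_full : {ae mu2, forall y, B y}).
Hypothesis g_limit : forall e : R, 0 < e ->
  exists2 s, step_kernel s & forall x y, A x -> B y -> `|g x y - s x y| <= e.

Let m1 := fine (mu1 setT).
Let m2 := fine (mu2 setT).

Lemma measurable_section x : A x -> measurable_fun setT (g x).
Proof.
move=> Ax; apply: (measurable_uniform_limit complete2 B_full) => e /g_limit[s hs gs].
exists (s x); last by move=> y; exact: gs.
by have := step_kernel_section x hs => /sub_Lfun_mfun; rewrite inE.
Qed.

(** Cauchy-Schwarz in y: the difference is the inner product of phi with the
    section g x - s x, whose square has integral at most e ^ 2 * m2. *)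
Lemma kernel_fun_close s (e : R) phi x : 0 <= e -> step_kernel s -> A x ->
  (forall y, B y -> `|g x y - s x y| <= e) ->
  `|kernel_fun g phi x - kernel_fun s phi x| ^+ 2 <= e ^+ 2 * m2 * L2_dot phi phi.
Proof.
move=> e0 hs Ax gs.
have Ls := step_kernel_section x hs.
have mk : measurable_fun setT (fun y => g x y - s x y).
  apply: measurable_funB; first exact: measurable_section.
  by have := Ls => /sub_Lfun_mfun; rewrite inE.
have ke : {ae mu2, forall y, `|g x y - s x y| <= e} by apply: filterS B_full.
have Lk := bounded_in_Lfun2 mu2_fin mk ke.
have Lg : g x \in Lfun mu2 2%:E.
  rewrite (_ : g x = fun y => (g x y - s x y) + s x y).
    exact: (Lfun_addr_closed mu2 (lee1n 2)).2.
  by apply/funext => y; rewrite subrK.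
have -> : kernel_fun g phi x - kernel_fun s phi x =
    L2_dot (toL2 mu2 (fun y => g x y - s x y)) phi.
  rewrite dot_toL2// /kernel_fun -RintegralB//; try exact: mulL2_integrable.
  by apply: eq_Rintegral => y _; rewrite mulrBl.
rewrite real_normK ?num_real//; apply: le_trans (L2_CauchySchwarz _ _) _.
rewrite ler_wpM2r ?L2_dot_ge0//.
have [K -> Kk] := toL2E Lk.
rewrite L2_dot_pi; under eq_Rintegral do rewrite Kk.
have le := bounded_integral_sqr mk ke.
have m2fin : mu2 setT \is a fin_num by rewrite ge0_fin_numE.
rewrite -lee_fin EFinM (fineK m2fin) /Rintegral fineK//.
rewrite ge0_fin_numE; last by apply: integral_ge0 => y _; rewrite lee_fin -expr2 sqr_ge0.
by apply: le_lt_trans le _; rewrite lte_mul_pinfty// lee_fin sqr_ge0.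
Qed.

(** The pointwise bound of [kernel_fun_close] is integrated in x.  It also shows
    that [kernel_fun g phi] is measurable and square integrable, so that
    [toL2] does not return its default value 0. *)
Lemma kernel_op_close (e : R) : 0 < e -> exists2 s, step_kernel s &
  forall phi, L2_dot (kernel_op g phi - kernel_op s phi)
                     (kernel_op g phi - kernel_op s phi) <= e ^+ 2 * L2_dot phi phi.
Proof.
move=> e0; pose e' := e / (m1 * m2 + 1).
have m0 : 0 <= m1 * m2 by rewrite mulr_ge0// fine_ge0.
have C0 : 0 < m1 * m2 + 1 by rewrite ltr_wpDl.
have e'0 : 0 < e' by rewrite divr_gt0.
have close (eps : R) : 0 < eps -> exists2 s, step_kernel s & forall phi x, A x ->
    `|kernel_fun g phi x - kernel_fun s phi x| <= eps * Num.sqrt (m2 * L2_dot phi phi).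
  move=> eps0; have [s hs gs] := g_limit eps0; exists s => // phi x Ax.
  rewrite -ler_sqr ?nnegrE ?mulr_ge0 ?sqrtr_ge0//; last exact: ltW.
  have D0 : 0 <= m2 * L2_dot phi phi by rewrite mulr_ge0 ?L2_dot_ge0// fine_ge0.
  rewrite exprMn (sqr_sqrtr D0) mulrA.
  by apply: kernel_fun_close => //; [exact: ltW|move=> y; exact: gs].
have [s hs gs] := close _ e'0; exists s => // phi.
have [r /(_ phi)[Ls _]] := step_kernel_finite_rank hs.
set D := m2 * L2_dot phi phi in gs.
have D0 : 0 <= D by rewrite mulr_ge0 ?L2_dot_ge0// fine_ge0.
have mg : measurable_fun setT (kernel_fun g phi).
  apply: (measurable_uniform_limit complete1 A_full) => eps eps0.
  have D1 : 0 < Num.sqrt D + 1 by rewrite ltr_wpDl ?sqrtr_ge0.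
  have [s' hs' gs'] := close _ (divr_gt0 eps0 D1).
  exists (kernel_fun s' phi).
    have [r' /(_ phi)[+ _]] := step_kernel_finite_rank hs'.
    by move=> /sub_Lfun_mfun; rewrite inE.
  move=> x Ax; apply: le_trans (gs' phi x Ax) _.
  by rewrite mulrAC ler_pdivrMr// ler_pM2l// lerDl.
have mk : measurable_fun setT (fun x => kernel_fun g phi x - kernel_fun s phi x).
  by apply: measurable_funB => //; have := Ls => /sub_Lfun_mfun; rewrite inE.
have ke : {ae mu1, forall x, `|kernel_fun g phi x - kernel_fun s phi x| <=
    e' * Num.sqrt D} by apply: filterS A_full => x; exact: gs.
have Lk := bounded_in_Lfun2 mu1_fin mk ke.
(* Additivity of toL2 is available for square-integrable functions only, so
   kernel_fun g phi is written as the sum of two of them. *)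
have -> : kernel_op g phi - kernel_op s phi =
    toL2 mu1 (fun x => kernel_fun g phi x - kernel_fun s phi x).
  rewrite /kernel_op -[in LHS](_ : (fun x => (kernel_fun g phi x - kernel_fun s phi x)
    + kernel_fun s phi x) = kernel_fun g phi).
    by rewrite toL2D// addrK.
  by apply/funext => x; rewrite subrK.
have [K -> Kk] := toL2E Lk.
rewrite L2_dot_pi; under eq_Rintegral do rewrite Kk.
have le := bounded_integral_sqr mk ke.
have m1fin : mu1 setT \is a fin_num by rewrite ge0_fin_numE.
have le2 : (e' * Num.sqrt D) ^+ 2 * m1 <= e ^+ 2 * L2_dot phi phi.
  rewrite exprMn sqr_sqrtr// /D.
  have -> : e' ^+ 2 * (m2 * L2_dot phi phi) * m1 = e' ^+ 2 * (m1 * m2) * L2_dot phi phi.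
    by ring.
  rewrite ler_wpM2r ?L2_dot_ge0// /e' expr_div_n -mulrA ler_piMr ?sqr_ge0//.
  rewrite mulrC ler_pdivrMr ?exprn_gt0// mul1r.
  apply: (@le_trans _ _ (m1 * m2 + 1)); first by rewrite lerDl.
  by rewrite expr2 ler_peMr ?(ltW C0)// lerDr.
apply: le_trans le2; rewrite -lee_fin EFinM (fineK m1fin) /Rintegral fineK//.
rewrite ge0_fin_numE; last by apply: integral_ge0 => y _; rewrite lee_fin -expr2 sqr_ge0.
by apply: le_lt_trans le _; rewrite lte_mul_pinfty// lee_fin sqr_ge0.
Qed.

End UniformLimit.
End KernelOperators.

(** * Block operators on a direct sum *)

Section DirectSum.
Context {R : realType} {I : finType} {disp : I -> measure_display}.
Context {T : forall i, measurableType (disp i)}.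
Variable mu : forall i, {measure set (T i) -> \bar R}.
Notation X := (L2sum mu).

Lemma L2sum_inner_product : inner_product (@L2sum_dot R I disp T mu).
Proof.
split.
- exact: L2sum_dotC.
- by move=> u v w; rewrite linearDl.
- by move=> c u w; rewrite linearZl_LR.
- by move=> u; rewrite sqr_sqrtr// L2sum_dot_ge0.
Qed.

Definition component_inj (i : I) (w : L2 (mu i)) : X :=
  @dfwith I (fun j => L2 (mu j)) (fun=> 0) i w.

Lemma component_injE i w : component_inj w i = w.
Proof. exact: dfwith_in. Qed.

Lemma component_inj_neq i j (w : L2 (mu i)) : i != j -> component_inj w j = 0.
Proof. by move=> ij; apply: dfwith_out. Qed.

Lemma component_inj_linear i : linear (@component_inj i).
Proof.
move=> c u v; apply: functional_extensionality_dep => j.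
have [->|ij] := eqVneq j i.
  transitivity (c *: component_inj u i + component_inj v i) => //.
  by rewrite !component_injE.
transitivity (c *: component_inj u j + component_inj v j) => //.
by rewrite !component_inj_neq 1?eq_sym// scaler0 addr0.
Qed.

Lemma component_inj_dot u i (w : L2 (mu i)) :
  L2sum_dot u (component_inj w) = L2_dot (u i) w.
Proof.
rewrite /L2sum_dot (bigD1 i)//= component_injE big1 ?addr0// => j ij.
rewrite component_inj_neq 1?eq_sym// L2_dotC.
by have := L2_dotZl 0 0 (u j); rewrite scale0r mul0r.
Qed.

Lemma L2sum_sumE (J : Type) (r : seq J) (P : pred J) (F : J -> X) i :
  (\sum_(j <- r | P j) F j) i = \sum_(j <- r | P j) F j i.
Proof. by elim/big_rec2 : _ => // j u v _ <-. Qed.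

Lemma le_component_norm (u : X) i : L2_dot (u i) (u i) <= `|u| ^+ 2.
Proof.
rewrite (norm_dot L2sum_inner_product) /L2sum_dot (bigD1 i)//= lerDl.
by apply: sumr_ge0 => j _; exact: L2_dot_ge0.
Qed.

(** The block (j, i) of an operator on the direct sum, seen as an operator on
    the whole sum: <u i, b> is the inner product of u with the image of b. *)
Lemma kernel_block_finite_rank_limit i j (g : T j -> T i -> R) A B :
  (mu j setT < +oo)%E -> (mu i setT < +oo)%E ->
  measure_is_complete (mu j) -> measure_is_complete (mu i) ->
  {ae mu j, forall x, A x} -> {ae mu i, forall y, B y} ->
  (forall e : R, 0 < e ->
    exists2 s, step_kernel s & forall x y, A x -> B y -> `|g x y - s x y| <= e) ->
  finite_rank_limit (@L2sum_dot R I disp T mu)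
    (fun u => component_inj (kernel_op (mu j) g (u i))).
Proof.
move=> finj fini cj ci Aj Bi gs e e0.
have [s hs close] := kernel_op_close finj fini cj ci Aj Bi gs e0.
have [r rP] := step_kernel_finite_rank finj fini hs.
exists [seq (component_inj p.1, component_inj p.2) | p <- r] => u.
have -> : rank_op (@L2sum_dot R I disp T mu)
    [seq (component_inj p.1, component_inj p.2) | p <- r] u =
    component_inj (kernel_op (mu j) s (u i)).
  rewrite (rP (u i)).2 /rank_op big_map.
  elim: (r) => [|p r' IH].
    rewrite !big_nil; apply: functional_extensionality_dep => k.
    have [->|ki] := eqVneq k j; first by rewrite component_injE.
    by rewrite component_inj_neq 1?eq_sym.
  by rewrite !big_cons component_inj_linear IH component_inj_dot.
have -> : component_inj (kernel_op (mu j) g (u i)) -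
    component_inj (kernel_op (mu j) s (u i)) =
    component_inj (kernel_op (mu j) g (u i) - kernel_op (mu j) s (u i)).
  by rewrite addrC -scaleN1r -component_inj_linear scaleN1r addrC.
rewrite -ler_sqr ?nnegrE ?mulr_ge0//; last exact: ltW.
rewrite (norm_dot L2sum_inner_product) component_inj_dot component_injE exprMn.
apply: le_trans (close _) _; rewrite ler_wpM2l ?sqr_ge0//.
exact: le_component_norm.
Qed.

End DirectSum.

(** * Smooth kernels on separated sets *)

Section SeparatedKernel.
Context {R : realType} {d : nat}.
Notation V := 'rV[R]_d.

Lemma Ck_continuous (W : normedModType R) k (D : set W) (f : W -> R) x :
  Ck k D f -> D x -> {for x, continuous f}.
Proof. by case: k => [|k] [fc _]; exact: fc. Qed.

(** The constant c is the value at (x, y) of the local continuous extension of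
    the kernel; (x, y) itself need not be in the domain of G. *)
Lemma smooth_kernel_oscillation k (D : set V) (G : V -> V -> R) x y (e : R) :
  smooth_off_diagonal k D G -> closure D x -> bdry D y -> x != y -> 0 < e ->
  exists c r, 0 < r /\ forall x' y', D x' -> bdry D y' -> ball x r x' -> ball y r y' ->
    `|G x' y' - c| <= e.
Proof.
move=> smG Dx Dy xy e0; have [W [g [oW Wxy gC gG]]] := smG _ _ Dx Dy xy.
have gc := Ck_continuous gC Wxy.
have : \forall q \near (x, y), W q /\ `|g (x, y) - g q| <= e.
  apply: filterI; first exact: open_nbhs_nbhs.
  by move/cvgrPdist_le : gc => /(_ _ e0).
move=> /nbhs_ballP [r /= r0 rP]; exists (g (x, y)), r; split=> // x' y' Dx' Dy' xx' yy'.
have [Wq gq] := rP (x', y') (conj xx' yy').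
by rewrite -(gG _ Wq)// distrC.
Qed.

(** A finite subcover of the compact product of the closures by rectangles on
    which G is almost constant is fed to [step_kernel_cover]. *)
Lemma smooth_kernel_step_limit k (D A B : set V) (G : V -> V -> R) :
  smooth_off_diagonal k D G -> compact (closure A) -> compact (closure B) ->
  A `<=` D -> closure B `<=` bdry D ->
  (forall x y, closure A x -> closure B y -> x != y) ->
  forall e : R, 0 < e -> exists2 s : surfaceType A -> surfaceType B -> R,
    step_kernel s & forall x y, A x -> B y -> `|G x y - s x y| <= e.
Proof.
move=> smG cA cB AD BD AB e e0.
have [cr crP] : {cr : V * V -> R * R & forall p, 
    (forall x y, A x -> B y -> ball p.1 (cr p).2 x -> ball p.2 (cr p).2 y ->
      `|G x y - (cr p).1| <= e) /\
    ((closure A `*` closure B) p -> 0 < (cr p).2)}.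
  apply: (@choice _ _ (fun p (cr : R * R) =>
    (forall x y, A x -> B y -> ball p.1 cr.2 x -> ball p.2 cr.2 y ->
      `|G x y - cr.1| <= e) /\ ((closure A `*` closure B) p -> 0 < cr.2))).
  move=> [x y]; have [[/= Ax By]|NAB] := pselect ((closure A `*` closure B) (x, y)).
    have Dx : closure D x by apply: closure_subset Ax.
    have [c [r [r0 cP]]] := smooth_kernel_oscillation smG Dx (BD _ By) (AB _ _ Ax By) e0.
    exists (c, r); split=> // x' y' Ax' By' xx' yy'.
    by apply: cP => //; [exact: AD|exact/BD/subset_closure].
  (* Away from the product of the closures radius 0 gives an empty rectangle. *)
  exists (0, 0); split=> // x' y' _ _ /=.
  by rewrite -ball_normE /= => /(le_lt_trans (normr_ge0 _)); rewrite ltxx.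
pose PT : ptopologicalType := HB.pack (V * V)%type
  (Topological.class (V * V)%type) (Pointed.class (V * V)%type).
have : @compact PT (closure A `*` closure B) by exact: compact_setX.
rewrite (@compact_cover PT) => /(_ _ (closure A `*` closure B)
  (fun p => (ball p (cr p).2)°)) [].
- by move=> p _; exact: open_interior.
- move=> p pAB; exists p => //; apply: nbhsx_ballx; exact: (crP p).2.
move=> F _ cover.
have [s hs sP] := @step_kernel_cover R _ _ (surfaceType A) (surfaceType B) _ (finmap.enum_fset F)
  (fun p => ball p.1 (cr p).2) (fun p => ball p.2 (cr p).2) (fun p => (cr p).1) G
  (fun x y => A x /\ B y) e
  (fun p => surface_measurable_ball A p.1 (cr p).2)
  (fun p => surface_measurable_ball B p.2 (cr p).2)
  (fun p x y AB => (crP p).1 x y AB.1 AB.2).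
exists s => // x y Ax By; apply: sP => //.
have [|p /= pF] := cover (x, y).
  by split; exact: subset_closure.
by move=> /interior_subset [xp yp]; exists p.
Qed.

End SeparatedKernel.

(** * Geometry of the slabs *)

Section SlabGeometry.
Context {R : realType} {d : nat}.
Variables (Omega : set 'rV[R]_d) (nu : 'rV[R]_d) (a H : R).
Hypotheses (nu1 : enorm nu = 1) (H0 : 0 < H).

Lemma edot_continuous : continuous (edot nu).
Proof.
rewrite (_ : edot nu = fun x => \sum_i nu 0 i * x 0 i)//.
elim: (index_enum _) => [|i r IH].
  rewrite (_ : (fun x => _) = fun=> 0); first exact: cst_continuous.
  by apply/funext => x; rewrite big_nil.
rewrite (_ : (fun x => _) =
    fun x : 'rV[R]_d => nu 0 i * x 0 i + \sum_(l <- r) nu 0 l * x 0 l).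
  move=> x.
  have c1 : (fun _ : 'rV[R]_d => nu 0 i) @ x --> nu 0 i.
    exact: (@cst_continuous _ R (nu 0 i) x).
  have c2 := @coord_continuous R 1 d 0 i x.
  exact: cvgD (cvgM c1 c2) (IH x).
by apply/funext => x; rewrite big_cons.
Qed.

Lemma closure_interface_level j x :
  closure (interface Omega nu a H j) x -> edot nu x = a + j%:R * H.
Proof.
have cl : closed [set x | edot nu x = a + j%:R * H].
  apply: (@closed_comp _ _ (edot nu) [set a + j%:R * H]).
    by move=> y _; exact: edot_continuous.
  exact: closed_eq.
by move=> xc; apply: cl; apply: closure_subset xc => y [].
Qed.

Lemma double_slab_level j x : double_slab Omega nu a H j.+1 x ->
  a + j%:R * H < edot nu x < a + j.+2%:R * H.
Proof.
rewrite /double_slab /slab /interface -!natr1 !mulrDl !mul1r /=.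
move: (H0) => H_gt0 [[[_ /andP[h1 h2]]|[_ h]]|[_ /andP[h1 h2]]]; apply/andP; split; lra.
Qed.

Lemma edotDr x y : edot nu (x + y) = edot nu x + edot nu y.
Proof. by rewrite /edot -big_split; apply: eq_bigr => i _; rewrite mxE mulrDr. Qed.

Lemma edotZr c x : edot nu (c *: x) = c * edot nu x.
Proof. by rewrite /edot mulr_sumr; apply: eq_bigr => i _; rewrite mxE mulrCA. Qed.

Lemma edot_nu : edot nu nu = 1.
Proof.
rewrite -[edot nu nu]sqr_sqrtr; first by rewrite -/(enorm nu) nu1 expr1n.
by apply: sumr_ge0 => i _; rewrite -expr2 sqr_ge0.
Qed.

(** A point x of Omega is approached along the normal direction, from above or
    from below according to the sign s; openness of Omega keeps the nearby
    points in Omega. *)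
Lemma interface_approach (s : R) (S : set 'rV[R]_d) x : open Omega -> Omega x ->
  `|s| = 1 ->
  (forall t : R, 0 < t < H -> Omega (x + (s * t) *: nu) -> S (x + (s * t) *: nu)) ->
  closure S x.
Proof.
move=> oO Ox s1 hS B Bx.
have /nbhs_ballP [r /= r0 rP] : nbhs x (B `&` Omega).
  by apply: filterI => //; exact: open_nbhs_nbhs.
pose t := Num.min r H / 2.
have m0 : 0 < Num.min r H by rewrite lt_min r0.
have t0 : 0 < t by rewrite divr_gt0.
have tm : t < Num.min r H by rewrite ltr_pdivrMr// mulr_natr mulr2n ltrDl.
have [|By Oy] := rP (x + (s * t) *: nu).
  rewrite -ball_normE /= opprD addNKr normrN normrZ normrM s1 mul1r gtr0_norm//.
  apply: (@le_lt_trans _ _ t).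
    by rewrite ler_piMr ?(ltW t0)// -nu1 norm_le_enorm.
  by apply: lt_le_trans tm _; rewrite ge_min lexx.
exists (x + (s * t) *: nu); split=> //; apply: hS => //.
by rewrite t0 (lt_le_trans tm)// ge_min lexx orbT.
Qed.

(** A neighbouring interface lies at an extreme level of the double slab: it is
    disjoint from the double slab, but is approached from one of its two slabs. *)
Lemma neighbour_interface_bdry i j : open Omega -> (i.+1 == j) || (j.+1 == i) ->
  closure (interface Omega nu a H i.+1) `<=` bdry (double_slab Omega nu a H j.+1).
Proof.
move=> oO ij x xi; split; last first.
  move=> /interior_subset /double_slab_level; rewrite (closure_interface_level xi).
  by case/orP: ij => /eqP <-; rewrite ltxx ?andbF.
have clcl := @closed_closure _ (double_slab Omega nu a H j.+1).
apply: clcl; apply: closure_subset xi => {}x [Ox xl].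
case/orP: ij => /eqP ij.
  apply: (@interface_approach 1) => //; first by rewrite normr1.
  move=> t /andP[t0 tH] Ot; left; left; split=> //=; rewrite -ij mul1r.
  rewrite edotDr edotZr edot_nu xl mulr1 -[i.+2%:R]natr1 mulrDl mul1r.
  by apply/andP; split; lra.
apply: (@interface_approach (-1)) => //; first by rewrite normrN normr1.
move=> t /andP[t0 tH] Ot; right; split=> //=; rewrite ij mulN1r.
rewrite edotDr edotZr edot_nu xl mulr1 -[i.+1%:R]natr1 mulrDl mul1r.
by apply/andP; split; lra.
Qed.

End SlabGeometry.

Lemma interface_surface_finite (R : realType) (d : nat) (Omega : set 'rV[R]_d.+1)
    (nu : 'rV[R]_d.+1) (a H : R) j :
  enorm nu = 1 -> compact (closure (interface Omega nu a H j)) ->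
  (surface_measure (interface Omega nu a H j) setT < +oo)%E.
Proof.
move=> nu1 cI; have [M [_ MP]] := compact_bounded cI.
rewrite /= /surface setTI /=.
apply: (@hyperplane_piece_finite _ _ nu (a + j%:R * H) (`|M| + 2)) => //.
  by move=> x [].
move=> x i Ax; apply: (@le_lt_trans _ _ `|x|).
  rewrite [leRHS]/Num.Def.normr/= mx_normrE.
  by apply/bigmax_geP; right => /=; exists (0, i).
apply: (@le_lt_trans _ _ (`|M| + 1)); last by rewrite ltrD2l ltr1n.
apply: (MP (`|M| + 1)); last exact: subset_closure.
by apply: le_lt_trans (ler_norm M) _; rewrite ltrDl.
Qed.

(** K is the sum of its blocks, and each block reads its kernel on the product
    of two interfaces whose closures are compact and lie at different levels. *)
Lemma equilibrium_K_finite_rank_limit (R : realType) (d N k : nat)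
  (Omega : set 'rV[R]_d.+1) (nu : 'rV[R]_d.+1) (a H : R)
  (G : 'I_N -> 'rV[R]_d.+1 -> 'rV[R]_d.+1 -> R) :
  open Omega -> enorm nu = 1 -> 0 < H ->
  (forall j : 'I_N, compact (closure (interface Omega nu a H j.+1))) ->
  (forall j : 'I_N, smooth_off_diagonal k (double_slab Omega nu a H j.+1) (G j)) ->
  finite_rank_limit (E := trace_space Omega nu a H N) (@L2sum_dot R _ _ _ _)
    (equilibrium_K Omega nu a H G).
Proof.
move=> oO nu1 H0 cI smG.
pose Gamma (j : 'I_N) := interface Omega nu a H j.+1.
pose mu (j : 'I_N) := surface_measure (Gamma j).
have -> : equilibrium_K Omega nu a H G = fun u : L2sum mu =>
    \sum_(j < N) \sum_(i < N | (i.+1 == j) || (j.+1 == i))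
      component_inj (@kernel_op R _ _ (surfaceType (Gamma j)) (surfaceType (Gamma i))
        (mu j) (mu i) (G j) (u i)).
  apply/funext => u; apply: functional_extensionality_dep => j.
  rewrite L2sum_sumE (bigD1 j)//= [X in _ + X]big1 ?addr0 => [|l lj].
    by rewrite L2sum_sumE; apply: eq_bigr => i _; rewrite component_injE.
  by rewrite L2sum_sumE big1// => i _; rewrite component_inj_neq.
apply: finite_rank_limit_sum => j _; apply: finite_rank_limit_sum => i ij.
have full l : {ae mu l, forall x, interface Omega nu a H l.+1 x}.
  exists (~` interface Omega nu a H l.+1); split=> //.
  - by apply: surface_null_measurable; exact: surface_setC.
  - exact: surface_setC.
apply: (@kernel_block_finite_rank_limit R _ _ _ mu i j (G j) (Gamma j) (Gamma i)) => //.
- exact: interface_surface_finite.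
- exact: interface_surface_finite.
- exact: measure_is_complete_caratheodory.
- exact: measure_is_complete_caratheodory.
apply: smooth_kernel_step_limit (smG j) (cI j) (cI i) _ _ _.
- by move=> x Ix; left; right.
- exact: neighbour_interface_bdry.
- move=> x y /closure_interface_level xl /closure_interface_level yl.
  apply/eqP => xy; move: xl; rewrite xy yl => /addrI/(mulIf (lt0r_neq0 H0))/eqP.
  rewrite eqr_nat eqSS => /eqP ijE.
  by case/orP: ij => /eqP; rewrite ijE => /eqP; rewrite ?eqn_leq ltnn ?andbF.
Qed.

Theorem proposition3p2 (R : realType) (d N k : nat) (hd : d = 2%N \/ d = 3%N)
  (Omega : set 'rV[R]_d) (A : diff_op2 R d) (nu : 'rV[R]_d) (a H : R)
  (G : 'I_N -> 'rV[R]_d -> 'rV[R]_d -> R)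
  (Omega_open : open Omega) (Omega_connected : connected Omega)
  (A_elliptic : elliptic A Omega)
  (Omega_slabs : slab_tessellation Omega nu a H N)
  (interface_compact : forall j : 'I_N,
    compact (closure (interface Omega nu a H j.+1)))
  (global_solvable : uniquely_solvable A Omega)
  (slab_solvable : forall i, (i <= N)%N ->
    uniquely_solvable A (slab Omega nu a H i))
  (double_slab_solvable : forall j : 'I_N,
    uniquely_solvable A (double_slab Omega nu a H j.+1))
  (G_poisson : forall j : 'I_N,
    poisson_kernel A (double_slab Omega nu a H j.+1) (G j))
  (G_smooth : forall j : 'I_N,
    smooth_off_diagonal k (double_slab Omega nu a H j.+1) (G j))
  (X : nat -> set (trace_space Omega nu a H N))
  (X_finite_dim : forall n, finite_dim_subspace (X n))
  (X_nested : forall n, X n `<=` X n.+1)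
  (X_dense : dense (\bigcup_n X n))
  (S_invertible : invertible_on setT (equilibrium_S Omega nu a H G)) :
  let S := equilibrium_S Omega nu a H G in
  let Sbar n := extended_S Omega nu a H G (X n) in
  let Sn n := projected_S Omega nu a H G (X n) in
  let norm_inv_S := opnorm setT (opinv setT S) in
  let norm_inv_Sbar n := opnorm setT (opinv setT (Sbar n)) in
  let norm_inv_Sn n := opnorm (X n) (opinv (X n) (Sn n)) in
  let gap n := opnorm setT (fun u => Sbar n u - S u) in
  (\forall n \near \oo,
    [/\ invertible_on setT (Sbar n),
        invertible_on (X n) (Sn n),
        norm_inv_S * gap n < 1,
        norm_inv_Sbar n <= norm_inv_S / (1 - norm_inv_S * gap n) &
        norm_inv_Sn n <= norm_inv_Sbar n]) /\
  (exists C : R, \forall n \near \oo,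
    norm_inv_Sbar n <= C /\ norm_inv_Sn n <= C).
Proof.
(* As d is positive, an interface lies in a hyperplane of dimension d - 1. *)
case: d hd Omega A nu G Omega_open Omega_connected A_elliptic Omega_slabs
  interface_compact global_solvable slab_solvable double_slab_solvable G_poisson
  G_smooth X X_finite_dim X_nested X_dense S_invertible => [|d'] hd Omega A nu G.
  by case: hd.
move=> Omega_open _ _ [nu1 H0 _ _] interface_compact _ _ _ _ G_smooth X
  X_finite_dim X_nested X_dense S_invertible.
have dotP := L2sum_inner_product
  (fun j : 'I_N => surface_measure (interface Omega nu a H j.+1)).
have sX n : subspace (X n) by exact: finite_dim_is_subspace.
have PX n : orthogonal_projection (@L2sum_dot R _ _ _ _) (X n) (@orth_proj R _ _ _ _ _ _ (X n)).
  by move=> u; rewrite /orth_proj; case: xgetP => [p -> //|no];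
    have [p pP] := projection_exists dotP u (X_finite_dim n); case: (no p).
have KF := equilibrium_K_finite_rank_limit Omega_open nu1 H0 interface_compact G_smooth.
exact: (projected_inverse_bounds dotP sX X_nested X_dense PX X_finite_dim KF S_invertible).
Qed.
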